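(* For each integer $n\ge1$, let $$x_j=\cos\left(\frac{j\pi}{n}+\varepsilon_j\right),\qquad j=0,\ldots,n,$$ be distinct nodes, where the $\varepsilon_j\in\mathbb{R}$ may depend on $n$, $\varepsilon_0=\varepsilon_n=0$, and $$\max_{0\le j\le n}|\varepsilon_j|\le\sigma_n .$$ Suppose moreover that, for some fixed $\eta$ (independent of $n$), $$n\sigma_n(\log n+1)\le\eta,\qquad 0<\eta<\left(1+\frac2\pi\right)^{-1}.$$ Let $\rho>1$, let $f$ be analytic in the open Bernstein ellipse $E_\rho$ and continuous on $\overline{E_\rho}$, and set $M_\rho=\max_{z\in\overline{E_\rho}}|f(z)|$. Let $\ell_j^\varepsilon$ be the Lagrange basis polynomials of the nodes $x_0,\ldots,x_n$ and let $I_n^\varepsilon f=\sum_{j=0}^n f(x_j)\ell_j^\varepsilon$ be the interpolant of $f$. Then, for every fixed integer $m\ge1$, there exists a constant $C_{\rho,m,\eta}>0$, independent of $n$, such that $$\left\|f^{(m)}-(I_n^\varepsilon f)^{(m)}\right\|_\infty\le C_{\rho,m,\eta}\,M_\rho\,n^{2m}\log(en)\,\rho^{-n}.$$ Consequently, $$\max_{0\le i\le n}\left|f^{(m)}(x_i)-\sum_{j=0}^n f(x_j)(\ell_j^\varepsilon)^{(m)}(x_i)\right|\le C_{\rho,m,\eta}\,M_\rho\,n^{2m}\log(en)\,\rho^{-n}.$$ In particular, for each fixed derivative order $m$, pseudospectral differentiation at the perturbed nodes is spectrally accurate (in the sense of these bounds).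
   Context: $\log$ denotes the natural logarithm and $\|\cdot\|_\infty$ is the supremum norm on $[-1,1]$. For $\rho>1$, the Bernstein ellipse $E_\rho$ is the open region of the complex plane bounded by the ellipse with foci $\pm1$ that is the image of the circle $|w|=\rho$ under $z=(w+w^{-1})/2$. The Lagrange basis polynomials are $\ell_j^\varepsilon(x)=\prod_{k\ne j}\frac{x-x_k}{x_j-x_k}$, so $I_n^\varepsilon f$ is the unique polynomial of degree at most $n$ agreeing with $f$ at $x_0,\ldots,x_n$. The pseudospectral approximation of $f^{(m)}$ is $(I_n^\varepsilon f)^{(m)}$, and the pseudospectral differentiation matrix has entries $(\ell_j^\varepsilon)^{(m)}(x_i)$. *)

(* Defs.v *)
From HB Require Import structures.
From mathcomp Require Export all_boot all_order all_algebra.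
From mathcomp Require Export complex.
From mathcomp Require Import ring.
From mathcomp Require Export all_classical all_reals all_analysis.
Export Order.TTheory GRing.Theory Num.Theory.
Export numFieldNormedType.Exports.
Export ComplexField.Normc.

Set Implicit Arguments.
Unset Strict Implicit.
Unset Printing Implicit Defensive.

Local Open Scope ring_scope.
Local Open Scope classical_set_scope.
Local Open Scope complex_scope.

Section Defs.
Variable R : realType.

Definition joukowski (w : R[i]) : R[i] := (w + w^-1) / 2.

(* The ellipse with foci -1 and 1 and major axis of length rho + rho^-1 is the
   image of the circle of radius rho (see bernstein_boundaryE below). *)
Definition bernstein_boundary (rho : R) : set R[i] :=
  [set z | normc (z - 1) + normc (z + 1) = rho + rho^-1].

Definition bernstein_ellipse (rho : R) : set R[i]^o :=
  [set z | normc (z - 1) + normc (z + 1) < rho + rho^-1].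

Lemma normc_sqrE (z : R[i]) :
  normc z ^+ 2 = complex.Re z ^+ 2 + complex.Im z ^+ 2.
Proof. by case: z => a b; rewrite /normc /= sqr_sqrtr // addr_ge0 ?sqr_ge0. Qed.

Lemma joukowski_foci (w : R[i]) : w != 0 ->
  normc (joukowski w - 1) + normc (joukowski w + 1) = normc w + (normc w)^-1.
Proof.
move=> w0; have two0 : (2 : R[i]) != 0 by rewrite pnatr_eq0.
have nw0 : normc w != 0 by apply: contra w0 => /eqP /eq0_normc ->.
have n2 : normc (2 : R[i]) = 2.
  by rewrite -[2]/(1 *+ 2) normcMn normc1.
have -> : joukowski w - 1 = (w - 1) ^+ 2 * (2 * w)^-1.
  by rewrite /joukowski; field.
have -> : joukowski w + 1 = (w + 1) ^+ 2 * (2 * w)^-1.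
  by rewrite /joukowski; field.
have -> : normc w + (normc w)^-1 =
    (2 * normc w ^+ 2 + 2) * (2 * normc w)^-1 by field.
rewrite !expr2 !normcM !normcV !normcM -!expr2 n2 -mulrDl; congr (_ * _).
by rewrite !normc_sqrE; case: w {w0 nw0} => a b /=; ring.
Qed.

Lemma bernstein_boundaryE (rho : R) : 1 < rho ->
  bernstein_boundary rho = joukowski @` [set w | normc w = rho].
Proof.
move=> rho1; have rho0 : 0 < rho by apply: lt_trans rho1.
apply/seteqP; split => [z /= zE | _ /= [w wrho <-]]; last first.
  rewrite /bernstein_boundary /= joukowski_foci ?wrho //.
  by apply: contraTneq rho0 => w0; rewrite -wrho w0 normc0 ltxx.
pose s := sqrtc (z ^+ 2 - 1).
have s2 : s ^+ 2 = z ^+ 2 - 1 by rewrite sqr_sqrtc.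
pose w := z + s.
have ww' : w * (z - s) = 1 by rewrite mulrC -subr_sqr s2; ring.
have w0 : w != 0.
  by apply/eqP => w0; move: ww'; rewrite w0 mul0r => /eqP; rewrite eq_sym oner_eq0.
have wV : w^-1 = z - s by rewrite -[LHS]mulr1 -ww' mulKf.
have two0 : (2 : R[i]) != 0 by rewrite pnatr_eq0.
have Jw : joukowski w = z by rewrite /joukowski wV /w; field.
have nw0 : normc w != 0 by apply: contra w0 => /eqP /eq0_normc ->.
move: (joukowski_foci w0); rewrite Jw zE => rE.
have : (normc w - rho) * (normc w * rho - 1) = 0.
  have rho_neq0 : rho != 0 by rewrite gt_eqF.
  have -> : (normc w - rho) * (normc w * rho - 1) =
    (normc w * rho) * ((normc w + (normc w)^-1) - (rho + rho^-1)).
    by field; rewrite rho_neq0 nw0.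
  by rewrite rE subrr mulr0.
move/eqP; rewrite mulf_eq0 !subr_eq0 => /orP[] /eqP r; first by exists w.
exists w^-1; last by rewrite -[RHS]Jw /joukowski invrK addrC.
by rewrite /= normcV -[LHS]mulr1 -r mulKf.
Qed.

(* [R[i]^o] is [R[i]] with its metric topology and its structure of normed space
   over itself, so that [f^`(m)] is a complex derivative. *)
Definition analytic_at (f : R[i]^o -> R[i]^o) (z0 : R[i]) :=
  exists (a : nat -> R[i]) (r : R), 0 < r /\
    forall z : R[i], normc (z - z0) < r ->
      (series (fun k => a k * (z - z0) ^+ k) : nat -> R[i]^o) @ \oo --> f z.

(* The value is extended so that an unbounded function has norm +oo, not 0. *)
Definition sup_norm (T : Type) (A : set T) (g : T -> R[i]) : \bar R :=
  ereal_sup [set (normc (g t))%:E | t in A].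

Definition max_norm (n : nat) (v : 'I_n.+1 -> R) : R :=
  \big[Num.max/(0 : R)]_(j < n.+1) `|v j|.

Definition perturbed_node (n : nat) (eps : 'I_n.+1 -> R) (j : 'I_n.+1) : R :=
  cos (j%:R * pi / n%:R + eps j).

Definition lagrange_basis (n : nat) (x : 'I_n.+1 -> R) (j : 'I_n.+1) :
    {poly R} :=
  \prod_(k < n.+1 | k != j) ((x j - x k)^-1 *: ('X - (x k)%:P)).

Definition interpolant (n : nat) (x : 'I_n.+1 -> R) (f : R[i] -> R[i]) :
    {poly R[i]} :=
  \sum_(j < n.+1)
    f (x j)%:C *: map_poly (real_complex R) (lagrange_basis x j).

Definition diff_matrix (n : nat) (x : 'I_n.+1 -> R) (m : nat) :
    'M[R]_n.+1 :=
  \matrix_(i, j) ((lagrange_basis x j)^`(m)).[x i].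

Definition pseudospectral_diff (n : nat) (x : 'I_n.+1 -> R) (m : nat)
    (f : R[i] -> R[i]) (i : 'I_n.+1) : R[i] :=
  \sum_(j < n.+1) f (x j)%:C * (diff_matrix x m i j)%:C.

End Defs.

(* Main.v *)
(** Let e_m(f) be the m-th Taylor coefficient at t in [-1, 1] of f - I_n f.  It is
    a linear functional of f, built from a Taylor coefficient of f at t and the
    values of f at the nodes, so Cauchy's formula on the ellipse z = (w + w^-1)/2,
    |w| = r < rho, writes it as the contour integral of f(z) e_m(1/(z - .)).  With
    omega the nodal polynomial, the error of interpolating 1/(z - .) is
    omega(t) / (omega(z) (z - t)), so only |omega(z)| from below on the ellipse and
    the Taylor coefficients of omega at t from above are needed.  The k-th one is at
    most n^(2k) prod_j (|t - x_j| + 1/n^2), which is O(n^(2k) 2^-n), while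
    |omega(z)| is at least a constant times (r/2)^n: both are proved by comparison
    with the Chebyshev nodes, for which the product is
    (w^(2n) - 1)(w^2 - 1) / (2w)^(n+1).  Finally r tends to rho.

    Contour integrals are replaced by limits of averages over roots of unity:
    for a function with a locally uniform first-order expansion, the averages over
    two circles differ by O(1/N), because radial and tangential difference quotients
    agree to first order and the tangential ones telescope. *)

From mathcomp Require Import ring lra zify.
From mathcomp Require Import cyclotomic.
Require Import Defs.

Set Implicit Arguments.
Unset Strict Implicit.
Unset Printing Implicit Defensive.

Local Open Scope classical_set_scope.
Local Open Scope complex_scope.
Local Open Scope ring_scope.

(** The logarithm in the hypothesis is spent inside [-1, 1]. On the ellipse every factor of omega(z)
    is bounded below, so n sigma <= 1 keeps the perturbed product comparable to the Chebyshev one. A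
    point t of [-1, 1] may be close to nodes: the relative perturbations then decay only like n
    sigma / (1 + |j - J|), and their sum costs n sigma (1 + ln n). The 1/n^2 added to each factor is
    the spacing of Chebyshev points near the ends (Markov's scale): it keeps the factors positive
    when t is a node, and dividing by its k-th power produces n^(2k). Cauchy's theorem rests on a
    symmetry: |w| = 1 covers [-1, 1] twice in opposite directions, so averages vanish there exactly,
    and changing the radius carries this zero outward. Poles in [-1, 1] block that route; they are
    split off by a Taylor polynomial and evaluated on large circles instead. The constants depend on
    r only through 1 + b <= r < rho, with b fixed by rho, which is what permits the limit in r. *)

Section ComplexModulus.
Variable R : realType.
Implicit Types (z : R[i]) (x : R).

Lemma normc_ge0 z : 0 <= normc z.
Proof. by case: z => a b; rewrite sqrtr_ge0. Qed.

Lemma normcE z : `|z| = (normc z)%:C.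
Proof. by rewrite normc_def; case: z. Qed.

Lemma normc_eq0 z : (normc z == 0) = (z == 0).
Proof. by apply/eqP/eqP => [/eq0_normc//|->]; exact: normc0. Qed.

Lemma normc_gt0 z : (0 < normc z) = (z != 0).
Proof. by rewrite lt_def normc_ge0 andbT normc_eq0. Qed.

Lemma normc_real x : normc x%:C = `|x|.
Proof. by rewrite /= expr0n addr0 sqrtr_sqr. Qed.

Lemma normcX z n : normc (z ^+ n) = normc z ^+ n.
Proof. by elim: n => [|n IH]; rewrite ?expr0 ?normc1// !exprS normcM IH. Qed.

Lemma normcBC z w : normc (z - w) = normc (w - z).
Proof. by rewrite -normcN opprB. Qed.

Lemma normc_sum (I : Type) (s : seq I) (P : pred I) (F : I -> R[i]) :
  normc (\sum_(i <- s | P i) F i) <= \sum_(i <- s | P i) normc (F i).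
Proof.
elim/big_ind2: _ => [|x a y b xa yb|//]; first by rewrite normc0.
by rewrite (le_trans (le_normcD _ _)) ?lerD.
Qed.

Lemma normc_prod (I : Type) (s : seq I) (P : pred I) (F : I -> R[i]) :
  normc (\prod_(i <- s | P i) F i) = \prod_(i <- s | P i) normc (F i).
Proof. by elim/big_ind2: _ => [|_ x _ y <- <-|//]; rewrite ?normc1 ?normcM. Qed.

Lemma le_normcB z w : normc (z - w) <= normc z + normc w.
Proof. by rewrite -(normcN w) le_normcD. Qed.

Lemma lerB_normc z w : normc z - normc w <= normc (z - w).
Proof. by rewrite lerBlDr -{1}(subrK w z) le_normcD. Qed.

Lemma normc_nat n : normc (n%:R : R[i]) = n%:R.
Proof. by rewrite normcMn normc1. Qed.

Lemma le_Re_normc z : `|complex.Re z| <= normc z.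
Proof. by case: z => a b /=; rewrite -sqrtr_sqr ler_wsqrtr// lerDl sqr_ge0. Qed.

Lemma le_Im_normc z : `|complex.Im z| <= normc z.
Proof. by case: z => a b /=; rewrite -sqrtr_sqr ler_wsqrtr// lerDr sqr_ge0. Qed.

Lemma normc_le_ReIm z : normc z <= `|complex.Re z| + `|complex.Im z|.
Proof.
rewrite -[leLHS]ger0_norm ?normc_ge0// -ler_sqr ?nnegrE ?addr_ge0//.
rewrite real_normK ?num_real// normc_sqrE sqrrD !real_normK ?num_real//.
by rewrite -addrA [X in _ <= _ + X]addrC addrA lerDl mulrn_wge0// mulr_ge0.
Qed.

(** The order of [R[i]] is partial: a positive element is real. This turns the complex-valued
    epsilons of the topology of [R[i]^o] into real ones. *)
Lemma complex_gt0 (e : R[i]) : 0 < e -> exists2 x : R, e = x%:C & 0 < x.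
Proof. by case: e => a b; rewrite ltcE /= => /andP[/eqP -> a0]; exists a. Qed.

Lemma cvgcP (u : nat -> R[i]^o) (l : R[i]^o) :
  u @ \oo --> l <->
  forall e : R, 0 < e -> \forall n \near \oo, normc (u n - l) < e.
Proof.
split=> [/cvgrPdist_lt ul e e0|ul].
  have /ul : 0 < e%:C :> R[i] by rewrite ltcR.
  by apply: filterS => n; rewrite normcE ltcR normcBC.
apply/cvgrPdist_lt => e /complex_gt0[x -> /ul]; apply: filterS => n.
by rewrite normcE ltcR normcBC.
Qed.

Lemma cvgc_normc_le (u : nat -> R[i]^o) (l : R[i]^o) (B : R) :
  u @ \oo --> l -> (\forall n \near \oo, normc (u n) <= B) -> normc l <= B.
Proof.
move=> /cvgcP ul uB; apply/ler_addgt0Pr => e /ul ue.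
near \oo => n.
have nB : normc (u n) <= B by near: n.
have ne : normc (u n - l) < e by near: n.
have -> : l = u n - (u n - l) by rewrite opprB addrC subrK.
by rewrite (le_trans (le_normcB _ _))// lerD// ltW.
Unshelve. all: by end_near. Qed.

Lemma cvgc_unique (u : nat -> R[i]^o) (l l' : R[i]^o) :
  u @ \oo --> l -> u @ \oo --> l' -> l = l'.
Proof. exact: cvg_unique. Qed.

(** Real and imaginary parts are dominated by the modulus, so each is an absolutely convergent real
    series. *)
Lemma cvgc_cauchy_normed (u : nat -> R[i]^o) :
  cvgn (series (fun k => normc (u k))) -> cvgn (series u).
Proof.
move=> nu.
have cR (p : R[i] -> R) : (forall z, `|p z| <= normc z) ->
    cvgn (series (fun k => p (u k))).
  move=> pz; apply: normed_cvg; apply: series_le_cvg nu => k //=.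
    exact: normc_ge0.
have [/cvg_ex[a /cvgrPdist_lt ha] /cvg_ex[b /cvgrPdist_lt hb]] :=
  (cR _ le_Re_normc, cR _ le_Im_normc).
apply/cvg_ex; exists (a +i* b); apply/cvgcP => e e0.
have e2 : 0 < e / 2 by rewrite divr_gt0.
near=> n; rewrite (le_lt_trans (normc_le_ReIm _))//.
rewrite [e](splitr e) ltrD//.
  have -> : complex.Re (series u n - (a +i* b)) =
      series (fun k => complex.Re (u k)) n - a.
    rewrite raddfB /=; congr (_ - _); rewrite /series /=.
    by rewrite (big_morph (id1:=0) (op1:=+%R) (@complex.Re R))// => -[? ?] [? ?].
  by rewrite distrC; near: n; exact: ha.
have -> : complex.Im (series u n - (a +i* b)) =
    series (fun k => complex.Im (u k)) n - b.
  rewrite raddfB /=; congr (_ - _); rewrite /series /=.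
  by rewrite (big_morph (id1:=0) (op1:=+%R) (@complex.Im R))// => -[? ?] [? ?].
by rewrite distrC; near: n; exact: hb.
Unshelve. all: by end_near. Qed.

End ComplexModulus.

(** * Power series: termwise derivatives and quadratic remainders *)

Section PowerSeries.
Variable R : realType.
Implicit Types (f g : R[i]^o -> R[i]^o) (a : nat -> R[i]) (z u v : R[i]).

(** The convergence clause of [analytic_at], with coefficients and radius exposed so that derived
    and quotient series can be named. *)
Definition psum f a z0 (r : R) := forall z, normc (z - z0) < r ->
  (series (fun k => a k * (z - z0) ^+ k) : nat -> R[i]^o) @ \oo --> f z.

(** Convergence at the single point z0 + s makes the terms tend to 0; the finitely many terms not
    yet below 1 are bounded by their sum. *)
Lemma psum_coef_bound f a z0 r s : 0 < s < r -> psum f a z0 r ->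
  exists B, forall k, normc (a k) * s ^+ k <= B.
Proof.
move=> /andP[s0 sr] fa.
have /fa/cvgP/cvg_series_cvg_0/cvgcP/(_ 1 ltr01)[N _ hN] :
  normc (z0 + s%:C - z0) < r by rewrite addrAC subrr add0r normc_real gtr0_norm.
have tE k : normc (a k) * s ^+ k = normc (a k * (z0 + s%:C - z0) ^+ k).
  by rewrite normcM normcX [z0 + _]addrC addrK normc_real gtr0_norm.
exists (1 + \sum_(k < N) normc (a k) * s ^+ k) => k.
have t0 j : 0 <= normc (a j) * s ^+ j by rewrite mulr_ge0 ?normc_ge0 ?exprn_ge0 ?ltW.
have [kN|Nk] := ltnP k N.
  by rewrite (bigD1 (Ordinal kN)) //= addrCA lerDl addr_ge0// sumr_ge0.
rewrite tE (@le_trans _ _ 1)//; last by rewrite lerDl sumr_ge0.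
by have /ltW := hN k Nk; rewrite subr0.
Qed.

Lemma sum_linear_geo n : \sum_(0 <= k < n) k.+1%:R * 2^-1 ^+ k <= 4 :> R.
Proof.
suff -> : \sum_(0 <= k < n) k.+1%:R * 2^-1 ^+ k
    = 4 - n.+2%:R * 2 * 2^-1 ^+ n :> R.
  by rewrite lerBlDr lerDl !mulr_ge0// exprn_ge0// invr_ge0.
elim: n => [|n IH]; first by rewrite big_geq// expr0; ring.
by rewrite big_nat_recr//= IH exprS -!natr1; set y := (_ : R) ^+ n; field.
Qed.

Lemma sum_square_geo n : \sum_(0 <= k < n) k%:R ^+ 2 * 2^-1 ^+ k <= 6 :> R.
Proof.
suff -> : \sum_(0 <= k < n) k%:R ^+ 2 * 2^-1 ^+ k
    = 6 - (n%:R ^+ 2 + 2 * n%:R + 3) * 2 * 2^-1 ^+ n :> R.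
  by rewrite lerBlDr lerDl !mulr_ge0// ?exprn_ge0 ?invr_ge0// !addr_ge0 ?mulr_ge0// sqr_ge0.
elim: n => [|n IH]; first by rewrite big_geq// expr0; ring.
by rewrite big_nat_recr//= IH [_ ^+ n.+1]exprS -natr1; set y := (_ : R) ^+ n; field.
Qed.

(** The factor [q ^+ 2] on the left avoids an exponent k - 2. The remainders satisfy R_(k+1) = v R_k
    + k u^(k-1) (v - u)^2, and k^2 + k <= (k + 1)^2 closes the induction. *)
Lemma taylor2_exp u v (q : R) k : 0 <= q -> normc u <= q -> normc v <= q ->
  q ^+ 2 * normc (v ^+ k - u ^+ k - (v - u) * (k%:R * u ^+ k.-1)) <=
  k%:R ^+ 2 * q ^+ k * normc (v - u) ^+ 2.
Proof.
move=> q0 uq vq; elim: k => [|k IH].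
  by rewrite !expr0 subrr mul0r mulr0 subr0 normc0 expr0n !mul0r mulr0.
have -> : v ^+ k.+1 - u ^+ k.+1 - (v - u) * (k.+1%:R * u ^+ k.+1.-1) =
    v * (v ^+ k - u ^+ k - (v - u) * (k%:R * u ^+ k.-1)) +
    k%:R * u ^+ k.-1 * (v - u) ^+ 2.
  case: k {IH} => [|k] /=; first by rewrite !expr0; ring.
  by rewrite !exprS -!natr1; ring.
have q2 : 0 <= q ^+ 2 by rewrite exprn_ge0.
apply: (@le_trans _ _ (q * (k%:R ^+ 2 * q ^+ k * normc (v - u) ^+ 2)
    + k%:R * q ^+ k.+1 * normc (v - u) ^+ 2)).
  rewrite (le_trans (ler_wpM2l q2 (le_normcD _ _)))// mulrDr lerD//.
    rewrite normcM [leLHS]mulrCA.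
    by apply: ler_pM => //; rewrite ?mulr_ge0 ?normc_ge0.
  rewrite normcM (normcX (v - u) 2) normcM normc_nat normcX mulrA.
  rewrite ler_wpM2r ?exprn_ge0 ?normc_ge0//.
  case: k {IH} => [|k] /=; first by rewrite !mul0r mulr0.
  rewrite mulrCA ler_wpM2l// -[k.+2]/(2 + k)%N exprD.
  by rewrite ler_wpM2l// lerXn2r ?nnegrE ?normc_ge0.
rewrite [q * _]mulrA -mulrDl ler_wpM2r ?exprn_ge0 ?normc_ge0//.
rewrite [q * _]mulrCA -exprS -mulrDl ler_wpM2r ?exprn_ge0//.
by rewrite -natr1 sqrrD expr1n mulr1 -addrA lerD2l mulr2n -addrA lerDl addr_ge0.
Qed.

Lemma psum_derivative f a z0 r : 0 < r -> psum f a z0 r ->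
  exists (g : R[i]^o -> R[i]^o) (q K : R), [/\ 0 < q, 0 <= K,
    psum g (fun k => k.+1%:R * a k.+1) z0 q &
    forall u v, normc (u - z0) < q -> normc (v - z0) < q ->
      normc (f v - f u - (v - u) * g u) <= K * normc (v - u) ^+ 2].
Proof.
(* Coefficients are bounded at radius s; at radius q = s / 2 the terms gain 2^-k, which makes the
   weights k + 1 (derivative) and k^2 (remainder) summable. *)
move=> r0 fa; pose s := r / 2; pose q := s / 2.
have s0 : 0 < s by rewrite divr_gt0.
have q0 : 0 < q by rewrite divr_gt0.
have sr : 0 < s < r by rewrite s0 /s; lra.
have qr : q < r by rewrite /q /s; lra.
have [B hB] := psum_coef_bound sr fa.
have B0 : 0 <= B by rewrite (le_trans _ (hB 0%N))// mulr_ge0 ?normc_ge0.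
have ak k : normc (a k) * q ^+ k <= B * 2^-1 ^+ k.
  by rewrite /q exprMn mulrA ler_wpM2r// exprn_ge0// invr_ge0.
pose t z k : R[i]^o := k.+1%:R * a k.+1 * (z - z0) ^+ k.
pose g z : R[i]^o := lim ((series (t z) : nat -> R[i]^o) @ \oo).
have tB z k : normc (z - z0) <= q ->
    normc (t z k) <= B / s * (k.+1%:R * 2^-1 ^+ k).
  move=> zq; rewrite !normcM normcX normc_nat mulrCA -mulrA ler_wpM2l//.
  rewrite -(ler_pM2r q0).
  apply: le_trans (_ : _ <= normc (a k.+1) * q ^+ k.+1) _.
    rewrite (exprSr q k) -[leLHS]mulrA ler_wpM2l ?normc_ge0//.
    rewrite (_ : q ^+ k * q = q * q ^+ k) ?[_ * q]mulrC ?ler_wpM2l ?(ltW q0)//.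
    by rewrite lerXn2r ?nnegrE ?normc_ge0// ltW.
  apply: le_trans (ak k.+1) _; rewrite /q exprS le_eqVlt; apply/orP; left.
  by apply/eqP; field; rewrite gt_eqF.
have tcvg z : normc (z - z0) <= q -> (series (t z) : nat -> R[i]^o) @ \oo --> g z.
  move=> zq; apply: cvgc_cauchy_normed.
  apply: (@series_le_cvg _ _ (fun k => B / s * (k.+1%:R * 2^-1 ^+ k))).
  - by move=> k; exact: normc_ge0.
  - by move=> k; rewrite !mulr_ge0 ?exprn_ge0 ?invr_ge0 ?(ltW s0)//.
  - by move=> k; exact: tB.
  apply: nondecreasing_is_cvgn.
    apply: nondecreasing_series => k _ _.
    by rewrite !mulr_ge0 ?exprn_ge0 ?invr_ge0 ?(ltW s0)//.
  exists (B / s * 4) => _ [n _ <-]; rewrite /series /= -mulr_sumr.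
  by rewrite ler_wpM2l ?sum_linear_geo// mulr_ge0// invr_ge0 ltW.
exists g, q, (B * 6 / q ^+ 2); split=> //.
- by rewrite !mulr_ge0// invr_ge0 exprn_ge0// ltW.
- by move=> z zq; apply: tcvg; exact: ltW.
move=> u v uq vq.
(* Partial sums of [f] are taken one term further: their termwise derivative is then exactly the
   n-term partial sum of [g]. *)
have Sf z : normc (z - z0) < q ->
    (fun n => series (fun k => a k * (z - z0) ^+ k) n.+1 : R[i]^o) @ \oo --> f z.
  by move=> zq; rewrite cvg_shiftS; apply: fa; exact: lt_trans qr.
apply: cvgc_normc_le (cvgB (cvgB (Sf _ vq) (Sf _ uq))
   (cvgM (cvg_cst ((v - u) : R[i]^o)) (tcvg _ (ltW uq)))) _.
near=> n => /=.
rewrite !fctE; rewrite /series /=.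
rewrite [\sum_(0 <= k < n) _](_ : _ =
    \sum_(0 <= k < n.+1) k%:R * a k * (u - z0) ^+ k.-1); last first.
  by rewrite big_nat_recl//= !mul0r add0r.
rewrite -!sumrB mulr_sumr -sumrB.
rewrite (le_trans (normc_sum _ _ _))//.
apply: (@le_trans _ _ (\sum_(0 <= k < n.+1) B / q ^+ 2 * normc (v - u) ^+ 2 *
   (k%:R ^+ 2 * 2^-1 ^+ k))); last first.
  rewrite -mulr_sumr (le_trans (ler_wpM2l _ (sum_square_geo _)))//.
    by rewrite !mulr_ge0 ?invr_ge0 ?exprn_ge0 ?normc_ge0// ltW.
  by rewrite le_eqVlt; apply/orP; left; apply/eqP; ring.
rewrite ler_sum// => k _.
have -> : a k * (v - z0) ^+ k - a k * (u - z0) ^+ k -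
    (v - u) * (k%:R * a k * (u - z0) ^+ k.-1) =
    a k * ((v - z0) ^+ k - (u - z0) ^+ k -
      ((v - z0) - (u - z0)) * (k%:R * (u - z0) ^+ k.-1)) by ring.
have := @taylor2_exp (u - z0) (v - z0) q k (ltW q0) (ltW uq) (ltW vq).
rewrite normcM; set X := normc (_ - _ - _) => hX.
rewrite -(ler_pM2l (exprn_gt0 2 q0)) mulrCA.
rewrite (le_trans (ler_wpM2l (normc_ge0 _) hX))//.
have -> : v - z0 - (u - z0) = v - u by ring.
have -> : normc (a k) * (k%:R ^+ 2 * q ^+ k * normc (v - u) ^+ 2) =
   normc (a k) * q ^+ k * (k%:R ^+ 2 * normc (v - u) ^+ 2) by ring.
apply: le_trans (ler_wpM2r _ (ak k)) _.
  by rewrite mulr_ge0// exprn_ge0// normc_ge0.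
by rewrite le_eqVlt; apply/orP; left; apply/eqP; field; rewrite gt_eqF.
Unshelve. all: by end_near. Qed.

Lemma derive1_quad f (g : R[i]) z0 (q K : R) : 0 < q -> 0 <= K ->
  (forall v, normc (v - z0) < q ->
     normc (f v - f z0 - (v - z0) * g) <= K * normc (v - z0) ^+ 2) ->
  (f^`())%classic z0 = g.
Proof.
move=> q0 K0 fg; apply: cvg_lim; first exact: norm_hausdorff.
apply/cvgrPdist_lt => e' /complex_gt0[e -> e0].
have d0 : 0 < Num.min q (e / (K + 1)).
  by rewrite lt_min q0 divr_gt0// ltr_wpDl.
near=> h.
have h0 : h != 0 by near: h; exact: nbhs_dnbhs_neq.
have : `|h| < (Num.min q (e / (K + 1)))%:C.
  by near: h; apply: dnbhs0_lt; rewrite ltcR.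
rewrite normcE ltcR lt_min => /andP[hq he].
have hn : 0 < normc h by rewrite normc_gt0.
rewrite normcE ltcR normcBC.
have -> : h^-1 *: (f (h + z0) - f z0) - g =
    h^-1 * (f (h + z0) - f z0 - (h + z0 - z0) * g).
  rewrite addrK [RHS]mulrBr mulrA mulVf ?mul1r//.
have /fg : normc (h + z0 - z0) < q by rewrite addrK.
rewrite normcM normcV addrK => hK.
rewrite -ltr_pdivlMl ?invr_gt0// invrK (le_lt_trans hK)//.
rewrite expr2 mulrCA ltr_pM2l//.
rewrite (le_lt_trans (_ : _ <= (K + 1) * normc h))//.
  by rewrite ler_wpM2r ?normc_ge0// lerDl.
by rewrite mulrC -ltr_pdivlMr// ltr_wpDl.
Unshelve. all: by end_near. Qed.

Lemma psum_derive1n m f a z0 r : 0 < r -> psum f a z0 r ->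
  (f^`(m))%classic z0 = m`!%:R * a m.
Proof.
elim: m f a r => [|m IH] f a r r0 fa.
  rewrite derive1n0 mul1r; have /fa : normc (z0 - z0) < r by rewrite subrr normc0.
  move=> /cvgc_unique; apply; apply/cvgcP => e e0; near=> n.
  have n0 : (0 < n)%N by near: n; exists 1%N.
  rewrite /series /= big_ltn// big_nat big1 ?addr0 ?expr0 ?mulr1 ?subrr ?normc0//.
  by move=> k /andP[k0 _]; rewrite expr0n gtn_eqF ?mulr0.
have [g [q [K [q0 K0 ga fg]]]] := psum_derivative r0 fa.
(* The radius is halved so that the disc of radius q / 2 around each such z stays where the
   expansion of [f] is uniform. *)
rewrite derive1Sn (IH _ _ (q / 2) _ (_ : psum _ (fun k => k.+1%:R * a k.+1) _ _)).
- by rewrite factS natrM mulrA [_ * m.+1%:R]mulrC.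
- by rewrite divr_gt0.
move=> z zq; have zq' : normc (z - z0) < q by lra.
rewrite (@derive1_quad f (g z) z (q / 2) K) ?divr_gt0//; first exact: ga.
move=> v vz; apply: fg => //.
have -> : v - z0 = (v - z) + (z - z0) by ring.
by rewrite (le_lt_trans (le_normcD _ _))//; lra.
Unshelve. all: by end_near. Qed.

End PowerSeries.

(** * Functions with a locally uniform first-order expansion *)

Section C11.
Variable R : realType.
Implicit Types (F G H : R[i] -> R[i]) (u v w : R[i]).

(* A locally uniform form of complex differentiability, weaker to establish than
   analyticity but sufficient for shifting contours. *)
Definition C11_at G u0 := exists (D : R[i] -> R[i]) (K e : R), 0 < e /\
  forall u v, normc (u - u0) < e -> normc (v - u0) < e ->
  [/\ normc (G u) <= K, normc (D u) <= K, normc (G v - G u) <= K * normc (v - u)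
    & normc (G v - G u - (v - u) * D u) <= K * normc (v - u) ^+ 2].

Lemma normcD_le u v (A B : R) : normc u <= A -> normc v <= B -> normc (u + v) <= A + B.
Proof. by move=> uA vB; rewrite (le_trans (le_normcD _ _))// lerD. Qed.

Lemma normcM_le u v (A B : R) : normc u <= A -> normc v <= B -> normc (u * v) <= A * B.
Proof. by move=> uA vB; rewrite normcM ler_pM// normc_ge0. Qed.

Lemma C11_ext G H u0 (e : R) : 0 < e ->
  (forall u, normc (u - u0) < e -> G u = H u) -> C11_at G u0 -> C11_at H u0.
Proof.
move=> e0 GH [D [K [d [d0 h]]]]; exists D, K, (Num.min e d).
split=> [|u v]; first by rewrite lt_min e0.
by rewrite !lt_min => /andP[ue ud] /andP[ve vd]; rewrite -!GH//; exact: h.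
Qed.

Lemma C11_cst (c u0 : R[i]) : C11_at (fun=> c) u0.
Proof.
exists (fun=> 0), (normc c), 1; split=> // u v _ _; have c0 := normc_ge0 c.
rewrite mulr0 subr0 !subrr !normc0; split=> //; rewrite mulr_ge0 ?normc_ge0//.
by rewrite exprn_ge0 ?normc_ge0.
Qed.

Lemma C11_id (u0 : R[i]) : C11_at id u0.
Proof.
have n0 := normc_ge0 u0.
exists (fun=> 1), (normc u0 + 1), 1; split=> // u v uu vv.
have d0 := normc_ge0 (v - u).
have -> : v - u - (v - u) * 1 = 0 by ring.
rewrite normc0 normc1; split.
- by rewrite -[u](subrK u0) addrC normcD_le// ltW.
- by rewrite lerDr.
- by rewrite ler_peMl// lerDr.
- by rewrite mulr_ge0 ?addr_ge0 ?exprn_ge0.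
Qed.

Lemma C11_add G H u0 : C11_at G u0 -> C11_at H u0 -> C11_at (fun u => G u + H u) u0.
Proof.
move=> [D [K [e [e0 h]]]] [D' [K' [e' [e'0 h']]]].
exists (fun u => D u + D' u), (K + K'), (Num.min e e').
split=> [|u v]; first by rewrite lt_min e0.
rewrite !lt_min => /andP[ue ue'] /andP[ve ve'].
have [h1 h2 h3 h4] := h u v ue ve; have [k1 k2 k3 k4] := h' u v ue' ve'.
rewrite !(mulrDl K); split; [exact: normcD_le|exact: normcD_le| |].
  have -> : G v + H v - (G u + H u) = (G v - G u) + (H v - H u) by ring.
  exact: normcD_le.
have -> : G v + H v - (G u + H u) - (v - u) * (D u + D' u) =
   (G v - G u - (v - u) * D u) + (H v - H u - (v - u) * D' u) by ring.
exact: normcD_le.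
Qed.

Lemma C11_mul G H u0 : C11_at G u0 -> C11_at H u0 -> C11_at (fun u => G u * H u) u0.
Proof.
move=> [D [K [e [e0 h]]]] [D' [K' [e' [e'0 h']]]].
exists (fun u => D u * H u + G u * D' u), (K * K' *+ 3), (Num.min e e').
split=> [|u v]; first by rewrite lt_min e0.
rewrite !lt_min => /andP[ue ue'] /andP[ve ve'].
have [h1 h2 h3 h4] := h u v ue ve; have [k1 k2 k3 k4] := h' u v ue' ve'.
have [h1v _ _ _] := h v u ve ue.
have d0 := normc_ge0 (v - u); set d := normc (v - u) in h3 h4 k3 k4 d0 *.
have KK : 0 <= K * K'.
  by rewrite mulr_ge0 ?(le_trans (normc_ge0 _) h1)// (le_trans (normc_ge0 _) k1).
split.
- by rewrite (le_trans (normcM_le h1 k1))//; lra.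
- rewrite (le_trans (normcD_le (normcM_le h2 k1) (normcM_le h1 k2)))//; lra.
- have -> : G v * H v - G u * H u = G v * (H v - H u) + (G v - G u) * H u by ring.
  rewrite (le_trans (normcD_le (normcM_le h1v k3) (normcM_le h3 k1)))//.
  have := mulr_ge0 KK d0; lra.
- have -> : G v * H v - G u * H u - (v - u) * (D u * H u + G u * D' u) =
    (G v - G u) * (H v - H u) + G u * (H v - H u - (v - u) * D' u) +
    (G v - G u - (v - u) * D u) * H u by ring.
  rewrite (le_trans (normcD_le (normcD_le (normcM_le h3 k3) (normcM_le h1 k4))
    (normcM_le h4 k1)))//.
  by rewrite le_eqVlt; apply/orP; left; apply/eqP; ring.
Qed.

Lemma C11_opp G u0 : C11_at G u0 -> C11_at (fun u => - G u) u0.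
Proof.
move=> /(C11_mul (C11_cst (-1) u0)); apply: (@C11_ext _ _ _ 1) => // u _.
by rewrite mulN1r.
Qed.

Lemma C11_exp G u0 n : C11_at G u0 -> C11_at (fun u => G u ^+ n) u0.
Proof.
move=> hG; elim: n => [|n IH]; first exact: C11_cst.
by apply: (@C11_ext _ _ _ 1) (C11_mul hG IH) => // u _; rewrite exprS.
Qed.

Lemma C11_sum (n : nat) (G : 'I_n -> R[i] -> R[i]) u0 :
  (forall j, C11_at (G j) u0) -> C11_at (fun u => \sum_(j < n) G j u) u0.
Proof.
elim: n G => [|n IH] G hG.
  by apply: (@C11_ext _ _ _ 1) (C11_cst 0 u0) => // u _; rewrite big_ord0.
apply: (@C11_ext _ _ _ 1) (C11_add (IH _ (fun j => hG (widen_ord (leqnSn n) j)))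
  (hG ord_max)) => // u _.
by rewrite big_ord_recr.
Qed.

Lemma C11_inv (u0 : R[i]) : u0 != 0 -> C11_at (fun u => u^-1) u0.
Proof.
rewrite -normc_gt0 => n0; pose c := normc u0 / 2.
have c0 : 0 < c by rewrite divr_gt0.
have ci : 0 <= c^-1 by rewrite invr_ge0 ltW.
have cle u : normc (u - u0) < c -> normc u^-1 <= c^-1 /\ u != 0.
  move=> uc; have uc' : c <= normc u.
    have := lerB_normc u0 (u0 - u); rewrite subKr normcBC.
    by move: uc; rewrite /c; lra.
  by rewrite normcV lef_pV2 ?posrE -?normc_gt0 ?(lt_le_trans c0).
exists (fun u => - (u^-1 * u^-1)), (c^-1 + c^-1 ^+ 2 + c^-1 ^+ 3), c.
split=> // u v /cle[iu u1] /cle[iv v1].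
have d0 := normc_ge0 (v - u); set d := normc (v - u) in d0 *.
have i2 := exprn_ge0 2 ci; have i3 := exprn_ge0 3 ci.
split.
- by rewrite (le_trans iu)//; lra.
- by rewrite normcN (le_trans (normcM_le iu iu))// -expr2; lra.
- have -> : v^-1 - u^-1 = (v^-1 * u^-1) * - (v - u) by field; rewrite u1.
  rewrite (@le_trans _ _ (c^-1 * c^-1 * d))//.
    by rewrite normcM_le ?normcM_le// normcN.
  by rewrite -expr2 ler_wpM2r//; lra.
- have -> : v^-1 - u^-1 - (v - u) * - (u^-1 * u^-1) =
     (v^-1 * u^-1 * u^-1) * ((v - u) * (v - u)) by field; rewrite u1.
  rewrite (@le_trans _ _ (c^-1 * c^-1 * c^-1 * (d * d)))//.
    by rewrite !normcM_le.
  rewrite -expr2 -exprSr -expr2 ler_wpM2r//; last by lra.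
  by rewrite exprn_ge0.
Qed.

Lemma C11_comp F G u0 : C11_at F (G u0) -> C11_at G u0 -> C11_at (fun u => F (G u)) u0.
Proof.
move=> [D [K [e [e0 h]]]] [D' [K' [e' [e'0 h']]]].
have K'0 : 0 <= K'.
  have u00 : normc (u0 - u0) < e' by rewrite subrr normc0.
  have [k _ _ _] := h' u0 u0 u00 u00.
  exact: le_trans (normc_ge0 _) k.
have K1 : 0 < K' + 1 by rewrite ltr_wpDl.
exists (fun u => D (G u) * D' u), (K + K * K' + K * K' ^+ 2), (Num.min e' (e / (K' + 1))).
split=> [|u v]; first by rewrite lt_min e'0 divr_gt0.
have Ge w : normc (w - u0) < e' -> normc (w - u0) < e / (K' + 1) -> normc (G w - G u0) < e.
  move=> we'; have /h' : normc (u0 - u0) < e' by rewrite subrr normc0.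
  move=> /(_ w we')[_ _ + _]; set x := normc (w - u0).
  have x0 : 0 <= x by exact: normc_ge0.
  by move=> a; rewrite ltr_pdivlMr// => b; lra.
rewrite !lt_min => /andP[ue' ue] /andP[ve' ve].
have [h1 h2 h3 h4] := h _ _ (Ge _ ue' ue) (Ge _ ve' ve).
have [k1 k2 k3 k4] := h' u v ue' ve'.
have K0 : 0 <= K by rewrite (le_trans _ h1) ?normc_ge0.
have d0 := normc_ge0 (v - u); set d := normc (v - u) in k3 k4 d0 *.
have KK := mulr_ge0 K0 K'0; have KKK := mulr_ge0 K0 (exprn_ge0 2 K'0).
split.
- by rewrite (le_trans h1)//; lra.
- by rewrite (le_trans (normcM_le h2 k2))//; lra.
- rewrite (le_trans h3)// (le_trans (ler_wpM2l K0 k3))// mulrA ler_wpM2r//; lra.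
- have -> : F (G v) - F (G u) - (v - u) * (D (G u) * D' u) =
    (F (G v) - F (G u) - (G v - G u) * D (G u)) +
    D (G u) * (G v - G u - (v - u) * D' u) by ring.
  rewrite (le_trans (normcD_le h4 (normcM_le h2 k4)))//.
  apply: (@le_trans _ _ (K * (K' * d) ^+ 2 + K * (K' * d ^+ 2))).
    by rewrite lerD2r ler_wpM2l// lerXn2r ?nnegrE ?normc_ge0// mulr_ge0.
  have -> : K * (K' * d) ^+ 2 + K * (K' * d ^+ 2) =
    (K * K' + K * K' ^+ 2) * d ^+ 2 by ring.
  by rewrite ler_wpM2r ?exprn_ge0//; lra.
Qed.

(** [C11_at] also asks for a local bound on the derivative, which comes from the expansion of the
    derivative itself; hence two uses of [psum_derivative]. *)
Lemma C11_psum (f : R[i]^o -> R[i]^o) a u0 (r : R) :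
  0 < r -> psum f a u0 r -> C11_at f u0.
Proof.
move=> r0 /(psum_derivative r0)[g [q [K [q0 K0 /(psum_derivative q0)]]]].
move=> [g1 [q1 [K1 [q10 K10 _ hg]]]] hf.
have e0 : 0 < Num.min 1 (Num.min q q1) by rewrite !lt_min ltr01 q0.
pose B := normc (g u0) + normc (g1 u0) + K1.
have z0q q' : 0 < q' -> normc (u0 - u0) < q' by rewrite subrr normc0.
have dle (f0 g0 : R[i]) (K2 : R) u h : 0 <= K2 -> normc (u - u0) < 1 ->
    normc (h - f0 - (u - u0) * g0) <= K2 * normc (u - u0) ^+ 2 ->
    normc h <= normc f0 + normc g0 + K2.
  move=> K20 u1 hh; have -> : h = f0 + (u - u0) * g0 + (h - f0 - (u - u0) * g0) by ring.
  have d0 := normc_ge0 (u - u0).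
  rewrite normcD_le//; last first.
    rewrite (le_trans hh)// ler_piMr// exprn_ile1// ltW//.
  by rewrite normcD_le// normcM ler_piMl ?normc_ge0// ltW.
exists g, (normc (f u0) + B + K *+ 2 + B + K), (Num.min 1 (Num.min q q1)); split=> //.
have B0 : 0 <= B by rewrite !addr_ge0 ?normc_ge0.
move=> u v; rewrite !lt_min => /and3P[u1 uq uq1] /and3P[v1 vq vq1].
have gB := dle _ _ _ _ _ K10 u1 (hg _ _ (z0q _ q10) uq1).
have fB := dle _ _ _ _ _ K0 u1 (hf _ _ (z0q _ q0) uq).
have n0 := normc_ge0 (f u0).
have gg : normc (g u0) <= B by rewrite /B -addrA lerDl addr_ge0 ?normc_ge0.
have d2 : normc (v - u) <= 2.
  have -> : v - u = (v - u0) - (u - u0) by ring.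
  by rewrite (le_trans (le_normcB _ _))//; lra.
have d0 := normc_ge0 (v - u).
have := hf _ _ uq vq; set d := normc (v - u) in d0 d2 *; move=> hd.
split.
- by lra.
- by rewrite (le_trans gB)// -/B; lra.
- have -> : f v - f u = (f v - f u - (v - u) * g u) + (v - u) * g u by ring.
  rewrite (le_trans (normcD_le hd (normcM_le (lexx _) gB)))// -/B -/d.
  apply: (@le_trans _ _ (K * 2 * d + B * d)).
    by rewrite [d * B]mulrC lerD2r expr2 mulrA ler_wpM2r// ler_wpM2l.
  by rewrite -mulrDl ler_wpM2r//; lra.
- by rewrite (le_trans hd)// ler_wpM2r ?exprn_ge0//; lra.
Qed.

(** Compactness of a square containing the annulus. A single parameter [C] going to [+oo] serves
    both as the bound and as the inverse of the radius, so that one filter handles both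
    constants. *)
Lemma C11_uniform G (r1 r2 : R) :
  (forall w, r1 <= normc w <= r2 -> C11_at G w) ->
  exists K e : R, [/\ 0 <= K, 0 < e & forall u, r1 <= normc u <= r2 ->
    exists D, forall v, normc (v - u) < e ->
      normc (G v - G u - (v - u) * D) <= K * normc (v - u) ^+ 2].
Proof.
move=> hG; pose Z (p : R * R) := p.1 +i* p.2.
pose P (C : R) (p : R * R) := r1 <= normc (Z p) <= r2 ->
  exists D, forall v, normc (v - Z p) < C^-1 ->
      normc (G v - G (Z p) - (v - Z p) * D) <= C * normc (v - Z p) ^+ 2.
have : compact (`[- r2, r2] `*` `[- r2, r2] : set (R * R)).
  by apply: compact_setX; exact: segment_compact.
have Znear (p : R * R) (e : R) : 0 < e -> \forall q \near p, normc (Z q - Z p) < e.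
  move=> e0; apply/nbhs_ballP; exists (e / 2); first by rewrite /= divr_gt0.
  move=> q [h1 h2].
  apply: le_lt_trans (normc_le_ReIm _) _; rewrite /= [e]splitr ltrD//.
    by rewrite distrC.
  by rewrite distrC.
move=> /compact_near_coveringP/(_ R +oo P).
(* The annulus is closed: near a point of the square outside it, [P] holds vacuously. *)
have far (p : R * R) (e : R) : 0 < e ->
   (forall q, normc (Z q - Z p) < e -> ~~ (r1 <= normc (Z q) <= r2)) ->
   \forall q \near p & C \near +oo, P C q.
  move=> e0 h; near=> q C; change (P C q) => hr.
  have : ~~ (r1 <= normc (Z q) <= r2) by apply: h; near: q; exact: Znear.
  by rewrite hr.
have PF p : (`[- r2, r2] `*` `[- r2, r2]) p -> \forall q \near p & C \near +oo, P C q.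
  move=> _; have [/andP[]|/nandP[]] := boolP (r1 <= normc (Z p) <= r2).
  - move=> p1 p2; have [|D [K [e [e0 h]]]] := hG (Z p); first by rewrite p1.
    have K0 : 0 <= K.
      have pp : normc (Z p - Z p) < e by rewrite subrr normc0.
      have [k _ _ _] := h _ _ pp pp.
      exact: le_trans (normc_ge0 _) k.
    have e2 : 0 < e / 2 by rewrite divr_gt0.
    near=> q C; change (P C q) => _; exists (D (Z q)) => v vC.
    have qp : normc (Z q - Z p) < e / 2 by near: q; exact: Znear.
    have CK : K <= C by near: C; apply: nbhs_pinfty_ge; exact: num_real.
    have C0 : 0 < C by near: C; exact: nbhs_pinfty_gt.
    have Ce : C^-1 <= e / 2.
      by rewrite -[leRHS]invrK lef_pV2 ?posrE ?invr_gt0.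
    have [||_ _ _ h4] := h (Z q) v; first by lra.
      have -> : v - Z p = (v - Z q) + (Z q - Z p) by ring.
      by rewrite (le_lt_trans (le_normcD _ _))//; lra.
    by rewrite (le_trans h4)// ler_wpM2r// exprn_ge0// normc_ge0.
  - rewrite -ltNge => p1; apply: (far _ (r1 - normc (Z p))); first by rewrite subr_gt0.
    move=> q hq; rewrite negb_and -ltNge; apply/orP; left.
    by have := lerB_normc (Z q) (Z p); lra.
  - rewrite -ltNge => p1; apply: (far _ (normc (Z p) - r2)); first by rewrite subr_gt0.
    move=> q hq; rewrite negb_and -!ltNge; apply/orP; right.
    by have := lerB_normc (Z p) (Z q); rewrite normcBC; lra.
move=> /(_ _ PF) hnear.
near (pinfty_nbhs R) => C.
have C0 : 0 < C by near: C; exact: nbhs_pinfty_gt.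
have KP : `[- r2, r2] `*` `[- r2, r2] `<=` P C by near: C.
exists C, C^-1; split; rewrite ?invr_gt0 ?ltW// => u /[dup] ur /andP[_ ur2].
have : P C (complex.Re u, complex.Im u).
  apply: KP; split; rewrite /= in_itv /= -ler_norml.
    by rewrite (le_trans (le_Re_normc _)).
  by rewrite (le_trans (le_Im_normc _)).
by rewrite /P /Z /=; case: u ur ur2 => x y /= ur ur2; apply.
Unshelve. all: by end_near. Qed.

End C11.

(** * The unit circle and its parametrisation *)

Section Cis.
Variable R : realType.
Implicit Types x y : R.

Definition cis x : R[i] := cos x +i* sin x.

Lemma cisD x y : cis (x + y) = cis x * cis y.
Proof. by rewrite /cis cosD sinD; simpc; congr (_ +i* _); ring. Qed.

Lemma cis0 : cis 0 = 1.
Proof. by rewrite /cis cos0 sin0. Qed.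

Lemma normc_cis x : normc (cis x) = 1.
Proof. by rewrite /= cos2Dsin2 sqrtr1. Qed.

Lemma cis_neq0 x : cis x != 0.
Proof. by rewrite -normc_gt0 normc_cis. Qed.

Lemma cisN x : cis (- x) = (cis x)^-1.
Proof. by apply: (mulfI (cis_neq0 x)); rewrite -cisD subrr cis0 divff ?cis_neq0. Qed.

Lemma cisX x n : cis x ^+ n = cis (n%:R * x).
Proof.
elim: n => [|n IH]; first by rewrite mul0r cis0.
by rewrite exprS IH -cisD -natr1; congr cis; ring.
Qed.

Lemma joukowski_cis x : joukowski (cis x) = (cos x)%:C.
Proof.
have -> : joukowski (cis x) = (cis x + cis (- x)) / 2 by rewrite cisN.
have -> : cis x + cis (- x) = (cos x)%:C * 2.
  rewrite mulr_natr mulr2n; apply/eqP; rewrite eq_complex /= cosN sinN.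
  by rewrite subrr addr0 !eqxx.
by rewrite mulfK// pnatr_eq0.
Qed.

Lemma ler_norm_sin x : `|sin x| <= `|x|.
Proof.
wlog x0 : x / 0 <= x.
  move=> H; have [/H//|/ltW xn] := leP 0 x.
  by have := H (- x); rewrite sinN !normrN oppr_ge0; exact.
have [->|xn0] := eqVneq x 0; first by rewrite sin0.
have xp : 0 < x by rewrite lt_def xn0.
have [|c _] := @MVT R sin cos 0 x xp.
  by apply: continuous_subspaceT => ?; exact: continuous_sin.
by rewrite sin0 !subr0 => ->; rewrite normrM ler_piMl// cos_max.
Qed.

End Cis.

(** * Averages over roots of unity and change of radius *)

Section Averages.
Variable R : realType.
Implicit Types (F G H : R[i] -> R[i]) (u v w : R[i]) (r : R) (N : nat).

Definition unity N : R[i] := cis (2 * pi / N%:R).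

Lemma unityX N : (0 < N)%N -> unity N ^+ N = 1.
Proof.
move=> N0; rewrite cisX.
have -> : N%:R * (2 * pi / N%:R) = pi *+ 2 :> R.
  by rewrite mulrC divfK ?pnatr_eq0 -?lt0n// mulr_natl.
by rewrite /cis cos2pi sin2pi.
Qed.

Lemma unity_neq1 N : (1 < N)%N -> unity N != 1.
Proof.
move=> N1; apply/eqP => /(congr1 (@complex.Re R)) /= c1.
have N0 : 0 < N%:R :> R by rewrite ltr0n; lia.
have pi0 := pi_gt0 R.
have /eqP : 2 * pi / N%:R = 0 :> R.
  apply: (@cos_inj R); rewrite ?c1 ?cos0// in_itv /=.
    apply/andP; split; first by rewrite divr_ge0 ?mulr_ge0 ?(ltW pi0) ?(ltW N0).
    by rewrite ler_pdivrMr// [leRHS]mulrC ler_wpM2r ?ler_nat ?(ltW pi0).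
  by rewrite lexx ltW.
by rewrite mulf_eq0 invr_eq0 (gt_eqF N0) orbF mulf_eq0 (gt_eqF pi0) pnatr_eq0.
Qed.

Lemma cvg_unity : (unity : nat -> R[i]^o) @ \oo --> (1 : R[i]^o).
Proof.
apply/cvgcP => e e0.
have h : (fun N => 2 * pi / N.+1%:R : R) @ \oo --> (0 : R).
  rewrite -(mulr0 (2 * pi)); apply: cvgM; first exact: cvg_cst.
  exact: cvg_harmonic.
have hc : cos (2 * pi / N.+1%:R) @[N --> \oo] --> (cos 0 : R).
  by apply: continuous_cvg; [exact: continuous_cos|exact: h].
have hs : sin (2 * pi / N.+1%:R) @[N --> \oo] --> (sin 0 : R).
  by apply: continuous_cvg; [exact: continuous_sin|exact: h].
rewrite cos0 in hc; rewrite sin0 in hs.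
have e2 : 0 < e / 2 by rewrite divr_gt0.
move/cvgrPdist_lt/(_ _ e2) : hc => [A _ hA].
move/cvgrPdist_lt/(_ _ e2) : hs => [B _ hB].
exists (maxn A B).+1 => // -[//|N] hN.
have /andP[AN BN] : (A <= N)%N && (B <= N)%N by rewrite -geq_max.
apply: le_lt_trans (normc_le_ReIm _) _; rewrite [e]splitr ltrD//=.
  by rewrite distrC; exact: hA.
by have := hB N BN; rewrite sub0r normrN oppr0 addr0.
Qed.

(** The rectangle rule for the mean over |w| = r, that is for (2 i pi)^-1 times the contour integral
    of G(w) / w; it is 0 for N = 0. *)
Definition cavg G r N : R[i]^o :=
  N%:R^-1 * \sum_(j < N) G (r%:C * unity N ^+ j).

Lemma normc_unity N j r : 0 <= r -> normc (r%:C * unity N ^+ j) = r.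
Proof. by move=> r0; rewrite normcM normcX normc_cis expr1n mulr1 normc_real ger0_norm. Qed.

Lemma eq_cavg G H r N : 0 <= r -> (forall w, normc w = r -> G w = H w) ->
  cavg G r N = cavg H r N.
Proof.
by move=> r0 GH; congr (_ * _); apply: eq_bigr => j _; rewrite GH ?normc_unity.
Qed.

Lemma normc_cavg_le G r N (B : R) : 0 <= r -> 0 <= B ->
  (forall w, normc w = r -> normc (G w) <= B) -> normc (cavg G r N) <= B.
Proof.
move=> r0 B0 GB; rewrite normcM normcV normc_nat.
have [->|N0] := posnP N; first by rewrite big_ord0 normc0 mulr0.
rewrite mulrC ler_pdivrMr ?ltr0n// (le_trans (normc_sum _ _ _))//.
apply: (@le_trans _ _ (\sum_(j < N) B)).
  by apply: ler_sum => j _; apply: GB; exact: normc_unity.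
by rewrite sumr_const card_ord mulr_natr.
Qed.

Lemma cavgD G H r N : cavg (fun w => G w + H w) r N = cavg G r N + cavg H r N.
Proof. by rewrite /cavg big_split mulrDr. Qed.

Lemma cavgZ (c : R[i]) G r N : cavg (fun w => c * G w) r N = c * cavg G r N.
Proof. by rewrite /cavg -mulr_sumr mulrCA. Qed.

Lemma cavgB G H r N : cavg (fun w => G w - H w) r N = cavg G r N - cavg H r N.
Proof. by rewrite /cavg sumrB mulrBr. Qed.

Lemma cavg_cst (c : R[i]) r N : (0 < N)%N -> cavg (fun=> c) r N = c.
Proof.
move=> N0; have N0' : N%:R != 0 :> R[i] by rewrite pnatr_eq0 -lt0n.
by apply: (mulfI N0'); rewrite /cavg mulrA divff// mul1r sumr_const card_ord mulr_natl.
Qed.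

(* On the circles of radii r and r', the radial difference quotient of G agrees
   up to O(|r' - r| + 1/N) with the tangential one, whose sum telescopes. *)
Lemma cavg_step G (K e r1 r2 : R) N r r' : 0 < r1 -> 0 <= K -> (1 < N)%N ->
  (forall u, r1 <= normc u <= r2 -> exists D, forall v, normc (v - u) < e ->
      normc (G v - G u - (v - u) * D) <= K * normc (v - u) ^+ 2) ->
  r1 <= r <= r2 -> `|r' - r| < e -> r2 * normc (unity N - 1) < e ->
  normc (cavg G r' N - cavg G r N) <=
    K * `|r' - r| * (`|r' - r| + r2 * normc (unity N - 1)).
Proof.
move=> r10 K0 N1 hG /andP[r1r rr2] r'e oe.
have r0 : 0 < r by exact: lt_le_trans r1r.
set o := unity N in oe *; set h := r' - r in r'e *.
have o1 : o - 1 != 0 by rewrite subr_eq0 unity_neq1.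
have on : 0 < normc (o - 1) by rewrite normc_gt0.
have rc0 : r%:C != 0 :> R[i] by rewrite -normc_gt0 normc_real gtr0_norm.
(* The ratio of the radial increment to the tangential one, the same for every j: subtracting k
   times the tangential difference cancels the first-order term in D. *)
pose k := h%:C / (r%:C * (o - 1)).
pose B := K * `|h| * (`|h| + r2 * normc (o - 1)).
have tele : \sum_(j < N) (G (r%:C * o ^+ j.+1) - G (r%:C * o ^+ j)) = 0.
  rewrite -(big_mkord xpredT (fun j => G (r%:C * o ^+ j.+1) - G (r%:C * o ^+ j))).
  by rewrite telescope_sumr// unityX ?expr0 ?subrr//; lia.
have -> : cavg G r' N - cavg G r N = N%:R^-1 * \sum_(j < N)
   (G (r'%:C * o ^+ j) - G (r%:C * o ^+ j)
    - k * (G (r%:C * o ^+ j.+1) - G (r%:C * o ^+ j))).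
  by rewrite sumrB -mulr_sumr tele mulr0 subr0 sumrB mulrBr.
rewrite normcM normcV normc_nat mulrC ler_pdivrMr ?ltr0n ?(ltn_trans _ N1)//.
rewrite (le_trans (normc_sum _ _ _))//.
apply: (@le_trans _ _ (\sum_(j < N) B)); last by rewrite sumr_const card_ord mulr_natr.
apply: ler_sum => j _; set u := r%:C * o ^+ j.
have nu : normc u = r by rewrite normc_unity// ltW.
have [|D hD] := hG u; first by rewrite nu r1r.
have e1 : r'%:C * o ^+ j - u = h%:C * o ^+ j by rewrite /u /h rmorphB /= mulrBl.
have e2 : r%:C * o ^+ j.+1 - u = r%:C * (o - 1) * o ^+ j by rewrite /u exprS; ring.
have n1 : normc (r'%:C * o ^+ j - u) = `|h|.
  by rewrite e1 normcM normcX normc_cis expr1n mulr1 normc_real.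
have n2 : normc (r%:C * o ^+ j.+1 - u) = r * normc (o - 1).
  by rewrite e2 !normcM normcX normc_cis expr1n mulr1 normc_real gtr0_norm.
have h1 : normc (r'%:C * o ^+ j - u) < e by rewrite n1.
have h2 : normc (r%:C * o ^+ j.+1 - u) < e.
  by rewrite n2 (le_lt_trans _ oe)// ler_wpM2r// ltW.
have := hD _ h1; have := hD _ h2; rewrite n1 n2 => b2 b1.
have -> : G (r'%:C * o ^+ j) - G u - k * (G (r%:C * o ^+ j.+1) - G u) =
  (G (r'%:C * o ^+ j) - G u - (r'%:C * o ^+ j - u) * D) -
  k * (G (r%:C * o ^+ j.+1) - G u - (r%:C * o ^+ j.+1 - u) * D).
  by rewrite e1 e2 /k; field; rewrite o1.
rewrite (le_trans (le_normcB _ _))// [normc (k * _)]normcM.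
have nk : normc k = `|h| / (r * normc (o - 1)).
  by rewrite normcM normcV normcM !normc_real (gtr0_norm r0).
apply: (@le_trans _ _ (K * `|h| ^+ 2 +
    `|h| / (r * normc (o - 1)) * (K * (r * normc (o - 1)) ^+ 2))).
  apply: lerD => //; rewrite nk; apply: ler_wpM2l => //.
  by apply: divr_ge0 => //; apply: mulr_ge0; exact: ltW.
have -> : K * `|h| ^+ 2 + `|h| / (r * normc (o - 1)) * (K * (r * normc (o - 1)) ^+ 2)
   = K * `|h| * (`|h| + r * normc (o - 1)).
  by field; rewrite (gt_eqF r0) (gt_eqF on).
by rewrite /B ler_wpM2l ?mulr_ge0// lerD2l ler_wpM2r// ltW.
Qed.

(** The error of [cavg_step] is quadratic in the step sizes, so crossing the annulus in radial steps
    no longer than the tangential chord leaves a total proportional to that chord, which tends to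
    0. *)
Lemma cavg_shift G r1 r2 : 0 < r1 <= r2 ->
  (forall w, r1 <= normc w <= r2 -> C11_at G w) ->
  (fun N => cavg G r2 N - cavg G r1 N : R[i]^o) @ \oo --> (0 : R[i]^o).
Proof.
move=> /andP[r10 r12] /C11_uniform[K [e [K0 e0 hG]]].
have r20 : 0 < r2 by exact: lt_le_trans r12.
have main N : (1 < N)%N -> r2 * normc (unity N - 1) < e ->
    normc (cavg G r2 N - cavg G r1 N) <= (2 * K * (r2 - r1) * r2) * normc (unity N - 1).
  move=> N1 Ne; set d := r2 * normc (unity N - 1).
  have d0 : 0 < d by rewrite mulr_gt0// normc_gt0 subr_eq0 unity_neq1.
  pose c := r2 - r1; have c0 : 0 <= c by rewrite subr_ge0.
  (* M > c / d makes each radial step c / M shorter than d; the M errors K (c / M) (c / M + d) then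
     sum to at most 2 K c d. *)
  pose M := Num.bound (c / d).
  have : c / d < M%:R by apply: archi_boundP; rewrite divr_ge0// ltW.
  have [->|M0] := posnP M; first by rewrite ltNge divr_ge0// ltW.
  have M0R : 0 < M%:R :> R by rewrite ltr0n.
  rewrite ltr_pdivrMr// mulrC -ltr_pdivrMr// => cM.
  pose s (k : nat) := r1 + k%:R * (c / M%:R).
  have h0 : 0 <= c / M%:R by rewrite divr_ge0// ltW.
  have sE k : s k.+1 - s k = c / M%:R by rewrite /s -natr1; ring.
  have -> : cavg G r2 N - cavg G r1 N =
      \sum_(0 <= k < M) (cavg G (s k.+1) N - cavg G (s k) N).
    rewrite telescope_sumr// /s mul0r addr0; congr (cavg _ _ _ - _).
    by rewrite mulrC divfK ?gt_eqF// /c addrC subrK.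
  rewrite (le_trans (normc_sum _ _ _))//.
  apply: (@le_trans _ _ (\sum_(0 <= k < M) K * (c / M%:R) * (d + d))).
    rewrite [leLHS]big_nat [leRHS]big_nat ler_sum// => k /andP[_ kM].
    have sk : r1 <= s k <= r2.
      rewrite /s lerDl mulr_ge0//= -lerBrDl -/c mulrCA ler_piMr// ler_pdivrMr//.
      by rewrite mul1r ler_nat ltnW.
    rewrite (le_trans (cavg_step r10 K0 N1 hG sk _ Ne))// sE ger0_norm//.
      by rewrite (lt_trans cM).
    by rewrite ler_wpM2l ?mulr_ge0// lerD2r ltW.
  rewrite sumr_const_nat subn0 -mulr_natr le_eqVlt; apply/orP; left; apply/eqP.
  by rewrite /d /c; field; rewrite gt_eqF.
apply/cvgcP => b b0; set A := 2 * K * (r2 - r1) * r2 in main.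
have A1 : 0 < A + 1.
  by rewrite ltr_wpDl// !mulr_ge0 ?subr_ge0// ltW.
have m0 : 0 < Num.min (e / r2) (b / (A + 1)) by rewrite lt_min !divr_gt0.
near=> N.
have N1 : (1 < N)%N by near: N; exists 2%N.
have : normc (unity N - 1) < Num.min (e / r2) (b / (A + 1)).
  by near: N; move/cvgcP : cvg_unity; apply.
rewrite lt_min => /andP[]; rewrite ltr_pdivlMr// mulrC => /(main _ N1) h.
rewrite ltr_pdivlMr// => h2; rewrite subr0 (le_lt_trans h)// (le_lt_trans _ h2)//.
by rewrite mulrC ler_wpM2l ?normc_ge0// lerDl.
Unshelve. all: by end_near. Qed.

End Averages.

(** * Contour averages on Bernstein ellipses *)

Section Contour.
Variable R : realType.
Implicit Types (F G H g : R[i] -> R[i]) (u v w z : R[i]) (r t rho : R) (N : nat).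

(** This is w dz/dw for z = joukowski w, hence the density of dz / (2 i pi) with respect to the
    normalised angle on |w| = r. *)
Definition joukowski_dlog w : R[i] := (w - w^-1) / 2.

(* With z = joukowski w on the ellipse |w| = r, this is the N-point rectangle
   rule for (2 i pi)^-1 times the contour integral of g. *)
Definition contour_avg r g : nat -> R[i]^o :=
  cavg (fun w => joukowski_dlog w * g (joukowski w)) r.

Lemma joukowskiV w : joukowski w^-1 = joukowski w.
Proof. by rewrite /joukowski invrK addrC. Qed.

Lemma joukowski_dlogV w : joukowski_dlog w^-1 = - joukowski_dlog w.
Proof. by rewrite /joukowski_dlog invrK -mulNr opprB. Qed.

Lemma C11_joukowski w : w != 0 -> C11_at (@joukowski R) w.
Proof. by move=> w0; apply/C11_mul/C11_cst/C11_add/C11_inv => //; exact: C11_id. Qed.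

Lemma C11_joukowski_dlog w : w != 0 -> C11_at joukowski_dlog w.
Proof.
move=> w0; apply/C11_mul/C11_cst/C11_add; first exact: C11_id.
exact/C11_opp/C11_inv.
Qed.

(** By [joukowski_foci] the focal sum is s + 1/s with s = |w|, and this is strictly increasing for s
    >= 1. *)
Lemma joukowski_in_bernstein rho w : 1 <= normc w < rho ->
  bernstein_ellipse rho (joukowski w).
Proof.
move=> /andP[w1 wr]; have w0 : 0 < normc w by exact: lt_le_trans w1.
rewrite /bernstein_ellipse /= joukowski_foci -?normc_gt0//.
have rho0 : 0 < rho by exact: lt_trans wr.
rewrite -subr_gt0.
have -> : rho + rho^-1 - (normc w + (normc w)^-1) =
   (rho - normc w) * (rho * normc w - 1) / (rho * normc w).
  by field; rewrite !gt_eqF.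
rewrite divr_gt0 ?mulr_gt0// ?subr_gt0//.
by rewrite (lt_le_trans (le_lt_trans w1 wr))// ler_peMr// ltW.
Qed.

Lemma real_joukowski t : -1 <= t <= 1 ->
  exists2 v, normc v = 1 & t%:C = joukowski v.
Proof.
by move=> t1; exists (cis (acos t)); rewrite ?normc_cis// joukowski_cis acosK.
Qed.

Lemma joukowskiB w v : w != 0 -> v != 0 ->
  joukowski w - joukowski v = (w - v) * (w - v^-1) / (2 * w).
Proof. by move=> w0 v0; rewrite /joukowski; field; rewrite v0 w0. Qed.

(** Write t = joukowski v with |v| = 1; both factors w - v and w - v^-1 of [joukowskiB] have modulus
    at least |w| - 1. *)
Lemma joukowski_dist w t : 1 < normc w -> -1 <= t <= 1 ->
  (normc w - 1) ^+ 2 / (2 * normc w) <= normc (joukowski w - t%:C).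
Proof.
move=> w1 /real_joukowski[v v1 ->].
have w0 : 0 < normc w by exact: lt_trans w1.
rewrite joukowskiB -?normc_gt0 ?v1// normcM normcV [normc (2 * w)]normcM (normc_nat _ 2).
rewrite ler_wpM2r ?invr_ge0 ?mulr_ge0 ?(ltW w0)// normcM expr2.
have m : 0 <= normc w - 1 by rewrite subr_ge0 ltW.
have := lerB_normc w v; have := lerB_normc w v^-1.
by rewrite normcV v1 invr1 => h1 h2; rewrite ler_pM.
Qed.

(* On the unit circle, w and w^-1 have the same image and opposite weights. *)
Lemma contour_avg1 g N : contour_avg 1 g N = 0.
Proof.
have [->|N0] := posnP N; first by rewrite /contour_avg /cavg big_ord0 mulr0.
rewrite /contour_avg /cavg.
pose F w := joukowski_dlog w * g (joukowski w); pose o := unity R N.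
have FV w : F w^-1 = - F w by rewrite /F joukowskiV joukowski_dlogV mulNr.
have oN : o ^+ N = 1 by exact: unityX.
have o0 k : o ^+ k != 0 by rewrite expf_neq0// cis_neq0.
rewrite (eq_bigr (fun j : 'I_N => F (o ^+ j))); last by move=> j _; rewrite mul1r.
suff S0 : \sum_(j < N) F (o ^+ j) = - \sum_(j < N) F (o ^+ j).
  rewrite [X in _ * X](_ : _ = 0) ?mulr0//; apply/eqP.
  have : (\sum_(j < N) F (o ^+ j)) *+ 2 == 0 by rewrite mulr2n {1}S0 addNr.
  by rewrite mulrn_eq0.
rewrite {1}(reindex_inj rev_ord_inj) /= -sumrN.
(* Reversal replaces o^j by the inverse of o^(j+1); the shift by one is harmless because o^N =
   o^0. *)
rewrite (eq_bigr (fun j : 'I_N => - F (o ^+ j.+1))); last first.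
  move=> j _; rewrite -FV; congr F; apply: (mulIf (o0 j.+1)).
  by rewrite mulVf// -exprD subnK// oN.
rewrite -(big_mkord xpredT (fun j => - F (o ^+ j.+1))).
rewrite -(big_mkord xpredT (fun j => - F (o ^+ j))).
case: N N0 @o oN o0 => // N _ o oN o0.
by rewrite big_nat_recr//= [RHS]big_nat_recl//= oN expr0 addrC.
Qed.

(** Cauchy's theorem: the ellipse is shrunk to the doubly covered segment [-1, 1], where the average
    is exactly 0. *)
Lemma contour_avg_C11 g rho r : 1 <= r < rho ->
  (forall z, bernstein_ellipse rho z -> C11_at g z) ->
  contour_avg r g @ \oo --> (0 : R[i]^o).
Proof.
move=> /andP[r1 rr] hg.
have -> : contour_avg r g = (fun N => contour_avg r g N - contour_avg 1 g N).
  by apply/funext => N; rewrite contour_avg1 subr0.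
apply: cavg_shift => [|w /andP[w1 wr]]; first by rewrite ltr01.
have w0 : w != 0 by rewrite -normc_gt0 (lt_le_trans _ w1).
apply: C11_mul; first exact: C11_joukowski_dlog.
apply: (C11_comp (F := g)); last exact: C11_joukowski.
by apply/hg/joukowski_in_bernstein; rewrite w1 (le_lt_trans wr).
Qed.

(* The average is independent of the radius up to o(1), and its limit for large
   radii is read off the behaviour of the integrand at infinity. *)
Lemma contour_avg_pole r t p : 1 < r -> -1 <= t <= 1 ->
  contour_avg r (fun z => (z - t%:C) ^- p.+1) @ \oo --> ((p == 0)%:R : R[i]^o).
Proof.
move=> r1 t1; apply/cvgcP => e e0.
(* On the circle of radius 3 + k, [joukowski_dist] yields |z - t| >= k / 2. The summand 12 / e
   brings the final error 6 / k below e / 2, and r keeps this circle outside the given one. *)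
pose k := 2 + r + 12 / e; have k2 : 2 <= k.
  by rewrite /k -addrA lerDl addr_ge0 ?divr_ge0 ?ltW// (lt_trans _ r1).
have k0 : 0 < k by rewrite (lt_le_trans _ k2).
have ke : 6 / k < e / 2.
  rewrite ltr_pdivrMr// mulrAC ltr_pdivlMr// -ltr_pdivrMl//.
  have : 0 < r by rewrite (lt_trans _ r1).
  by rewrite /k (_ : e^-1 * (6 * 2) = 12 / e); [lra|ring].
pose G w := joukowski_dlog w * (joukowski w - t%:C) ^- p.+1.
have xk w : normc w = 3 + k -> k / 2 <= normc (joukowski w - t%:C).
  move=> wk; have w1 : 1 < normc w by rewrite wk; lra.
  apply: le_trans (joukowski_dist w1 t1); rewrite wk ler_pdivlMr; last by lra.
  by have := ltW k0; nra.
have bnd w : normc w = 3 + k -> normc (G w - (p == 0)%:R) <= 6 / k.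
  move=> wk; have := xk w wk; set x := joukowski w - t%:C => hx.
  have x0 : x != 0 by rewrite -normc_gt0 (lt_le_trans _ hx)// divr_gt0.
  have xV : normc x^-1 <= 2 / k.
    by rewrite normcV -[leRHS]invrK invf_div lef_pV2 ?posrE ?divr_gt0// normc_gt0.
  have w0 : w != 0 by rewrite -normc_gt0 wk; lra.
  have Wx : normc (joukowski_dlog w / x - 1) <= 4 / k.
    (* The weight differs from z - t only by t - 1/w, of modulus at most 2: a simple pole averages
       to 1 up to O(1/k), and every further factor 1 / (z - t) is O(1/k). *)
    have -> : joukowski_dlog w / x - 1 = (t%:C - w^-1) / x.
      apply: (mulIf x0); rewrite mulrBl !divfK// mul1r /x /joukowski /joukowski_dlog.
      by field; rewrite w0.
    rewrite [leRHS](_ : _ = 2 * (2 / k)); last by ring.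
    apply: normcM_le => //; rewrite (le_trans (le_normcB _ _))//.
    rewrite normc_real normcV wk; have : `|t| <= 1 by rewrite ler_norml.
    suff : (3 + k)^-1 <= 1 by lra.
    by rewrite invf_le1; lra.
  rewrite /G -/x {G}; case: p => [|p] /=.
    by rewrite expr1 (le_trans Wx)// ler_wpM2r ?invr_ge0 ?(ltW k0)// ler_nat.
  rewrite subr0 exprS invfM mulrA -exprVn.
  have -> : joukowski_dlog w / x = 1 + (joukowski_dlog w / x - 1) by ring.
  have ik : 2 / k <= 1 by rewrite ler_pdivrMr// mul1r.
  have ik0 : 0 <= 2 / k by rewrite divr_ge0// ltW.
  rewrite [leRHS](_ : _ = (1 + 2) * (2 / k)); last by ring.
  apply: normcM_le.
    rewrite normcD_le ?normc1// (le_trans Wx)//.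
    by rewrite ler_pdivrMr//; lra.
  rewrite normcX (@le_trans _ _ ((2 / k) ^+ p.+1))//.
    by rewrite lerXn2r ?nnegrE ?normc_ge0.
  by rewrite exprS ler_piMr// exprn_ile1.
have : (fun N => cavg G (3 + k) N - cavg G r N : R[i]^o) @ \oo --> (0 : R[i]^o).
  apply: cavg_shift => [|w /andP[w1 _]].
    rewrite (lt_trans _ r1)//= /k; have : 0 <= 12 / e by rewrite divr_ge0// ltW.
    by lra.
  have w1' : 1 < normc w by exact: lt_le_trans w1.
  have w0 : 0 < normc w by exact: lt_trans w1'.
  apply: C11_mul; first by apply: C11_joukowski_dlog; rewrite -normc_gt0.
  have x0 : joukowski w - t%:C != 0.
    rewrite -normc_gt0 (lt_le_trans _ (joukowski_dist w1' t1))//.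
    by rewrite divr_gt0 ?exprn_gt0 ?mulr_gt0 ?subr_gt0.
  apply: (C11_comp (F := GRing.inv)); first by apply/C11_inv; rewrite expf_neq0.
  by apply/C11_exp/C11_add/C11_cst/C11_joukowski; rewrite -normc_gt0.
have e2 : 0 < e / 2 by rewrite divr_gt0.
move=> /cvgcP/(_ _ e2) hN; near=> N.
have N0 : (0 < N)%N by near: N; exists 1%N.
have : normc (cavg G (3 + k) N - cavg G r N - 0) < e / 2 by near: N.
rewrite subr0 => hd.
have -> : contour_avg r (fun z => (z - t%:C) ^- p.+1) N - (p == 0)%:R =
   cavg (fun w => G w - (p == 0)%:R) (3 + k) N - (cavg G (3 + k) N - cavg G r N).
  by rewrite cavgB cavg_cst// /contour_avg -/G; ring.
rewrite (le_lt_trans (le_normcB _ _))// [e]splitr ltrD//.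
rewrite (le_lt_trans _ ke)// normc_cavg_le//; first by lra.
by rewrite divr_ge0// ltW.
Unshelve. all: by end_near. Qed.

End Contour.

(** * Cauchy's formula for Taylor coefficients *)

Section CauchyCoefficients.
Variable R : realType.
Implicit Types (f : R[i]^o -> R[i]^o) (g : R[i] -> R[i]) (a : nat -> R[i]).
Implicit Types (z w : R[i]) (t r rho : R).

Lemma cvgc_sum n (u : 'I_n -> nat -> R[i]^o) (l : 'I_n -> R[i]^o) :
  (forall j, u j @ \oo --> l j) ->
  (fun N => \sum_(j < n) u j N) @ \oo --> (\sum_(j < n) l j).
Proof.
elim: n u l => [|n IH] u l ul.
  rewrite big_ord0; under eq_fun do rewrite big_ord0.
  exact: cvg_cst.
rewrite big_ord_recr; under eq_fun do rewrite big_ord_recr /=.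
by apply: cvgD; [exact: IH|exact: ul].
Qed.

Lemma contour_avgD r g g' N :
  contour_avg r (fun z => g z + g' z) N = contour_avg r g N + contour_avg r g' N.
Proof. by rewrite -cavgD; congr (_ * _); apply: eq_bigr => j _; rewrite mulrDr. Qed.

Lemma contour_avgZ r (c : R[i]) g N :
  contour_avg r (fun z => c * g z) N = c * contour_avg r g N.
Proof. by rewrite -cavgZ; congr (_ * _); apply: eq_bigr => j _; rewrite mulrCA. Qed.

Lemma contour_avg_sum r n (c : 'I_n -> R[i]) (g : 'I_n -> R[i] -> R[i]) N :
  contour_avg r (fun z => \sum_(j < n) c j * g j z) N =
  \sum_(j < n) c j * contour_avg r (g j) N.
Proof.
under [RHS]eq_bigr do rewrite -contour_avgZ.
rewrite /contour_avg /cavg -mulr_sumr exchange_big; congr (_ * _).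
by apply: eq_bigr => j _; rewrite mulr_sumr.
Qed.

Lemma eq_contour_avg r g g' N : 0 <= r ->
  (forall w, normc w = r -> g (joukowski w) = g' (joukowski w)) ->
  contour_avg r g N = contour_avg r g' N.
Proof. by move=> r0 gg; apply: eq_cavg => // w wr; rewrite gg. Qed.

(** Subtracting the Taylor polynomial leaves a removable singularity, filled by [a m.+1]; f(z) / (z
    - z0)^(m+1) is this function plus pure poles. *)
Definition taylor_quotient f a z0 m z :=
  if z == z0 then a m.+1
  else (f z - \sum_(l < m.+1) a l * (z - z0) ^+ l) / (z - z0) ^+ m.+1.

Lemma psum_taylor_quotient f a z0 r0 m : psum f a z0 r0 ->
  psum (taylor_quotient f a z0 m) (fun k => a (k + m.+1)%N) z0 r0.
Proof.
move=> fa z zr; rewrite /taylor_quotient; have [->|zz0] := eqVneq z z0.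
  apply/cvgcP => e e0; near=> n.
  have n0 : (0 < n)%N by near: n; exists 1%N.
  rewrite /series /= big_ltn// big_nat big1 ?addr0 ?expr0 ?mulr1 ?subrr ?normc0//.
  by move=> k /andP[k0 _]; rewrite expr0n gtn_eqF ?mulr0.
have d0 : (z - z0) ^+ m.+1 != 0 by rewrite expf_neq0// subr_eq0.
have := fa z zr; rewrite -(cvg_shiftn m.+1) => h.
have -> : series (fun k => a (k + m.+1)%N * (z - z0) ^+ k) = fun n =>
    (series (fun k => a k * (z - z0) ^+ k) (n + m.+1)%N -
      \sum_(l < m.+1) a l * (z - z0) ^+ l) / (z - z0) ^+ m.+1.
  apply/funext => n; apply: (mulIf d0); rewrite divfK// /series /= addnC.
  rewrite (big_cat_nat (leq0n m.+1) (leq_addr n m.+1)) [X in X + _ - _]big_mkord /= addrAC subrr add0r.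
  transitivity (\sum_(0 + m.+1 <= i < m.+1 + n) a i * (z - z0) ^+ i); last by [].
  rewrite big_addn addKn mulr_suml.
  apply: eq_bigr => k _; by rewrite exprD mulrA.
apply: cvgM; last exact: cvg_cst.
by apply: cvgB; [exact: h|exact: cvg_cst].
Unshelve. all: by end_near. Qed.

(** The regular part [phi] averages to 0 in the limit, and among the poles a_l (z - t)^-(m-l+1) only
    the simple one, l = m, contributes. *)
Lemma contour_avg_coef f a t r0 rho r m : -1 <= t <= 1 -> 1 < r < rho ->
  0 < r0 -> psum f a t%:C r0 ->
  (forall z, bernstein_ellipse rho z -> analytic_at f z) ->
  contour_avg r (fun z => f z / (z - t%:C) ^+ m.+1) @ \oo --> (a m : R[i]^o).
Proof.
move=> t1 /andP[r1 rrho] r00 fa fan; set t' := t%:C.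
have rg0 : 0 < r by exact: lt_trans r1.
pose phi := taylor_quotient f a t' m.
have C11phi z : bernstein_ellipse rho z -> C11_at phi z.
  move=> zE; have [->|zt] := eqVneq z t'.
    exact: C11_psum r00 (@psum_taylor_quotient _ _ _ _ m fa).
  have zt0 : z - t' != 0 by rewrite subr_eq0.
  have n0 : 0 < normc (z - t') by rewrite normc_gt0.
  have [b [rz [rz0 fz]]] := fan z zE.
  apply: (@C11_ext _ (fun u => (f u - \sum_(l < m.+1) a l * (u - t') ^+ l) *
     ((u - t') ^+ m.+1)^-1) _ _ (normc (z - t'))) => //.
    move=> u uz; rewrite /phi /taylor_quotient; case: eqVneq => // ut.
    by move: uz; rewrite ut normcBC ltxx.
  have C11X k : C11_at (fun u => (u - t') ^+ k) z.
    exact/C11_exp/C11_add/C11_cst/C11_id.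
  apply: C11_mul; last first.
    by apply: (C11_comp (F := GRing.inv)); [apply/C11_inv; rewrite expf_neq0|].
  apply: C11_add; first exact: C11_psum rz0 fz.
  by apply/C11_opp/C11_sum => l; apply: C11_mul; [exact: C11_cst|].
have -> : contour_avg r (fun z => f z / (z - t') ^+ m.+1) = (fun N =>
    contour_avg r phi N +
    \sum_(l < m.+1) a l * contour_avg r (fun z => (z - t') ^- (m - l).+1) N).
  apply/funext => N; rewrite -contour_avg_sum -contour_avgD.
  apply: eq_contour_avg; first exact: ltW.
  move=> w wr; have w1 : 1 < normc w by rewrite wr.
  have x0 : joukowski w - t' != 0.
    rewrite -normc_gt0 (lt_le_trans _ (joukowski_dist w1 t1))//.
    by rewrite divr_gt0 ?exprn_gt0 ?mulr_gt0 ?subr_gt0// (lt_trans _ w1).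
  rewrite /phi /taylor_quotient -[joukowski w == t']subr_eq0 (negbTE x0).
  rewrite mulrBl -[LHS](subrK 0) subr0 -[RHS]addrA; congr (_ + _).
  rewrite mulr_suml -sumrN -big_split /= big1// => l _.
  rewrite (_ : (joukowski w - t') ^+ m.+1 =
    (joukowski w - t') ^+ l * (joukowski w - t') ^+ (m - l).+1); last first.
    by rewrite -exprD addnS subnKC// -ltnS.
  by rewrite invfM mulrA mulfK ?expf_neq0// addNr.
have -> : (a m : R[i]^o) =
   0 + \sum_(l < m.+1) (a l * ((m - l)%N == 0)%:R : R[i]^o).
  rewrite add0r big_ord_recr /= subnn eqxx mulr1 big1 ?add0r// => l _.
  by rewrite subn_eq0 leqNgt ltn_ord mulr0.
apply: cvgD.
  by apply: (contour_avg_C11 (rho := rho)) => //; rewrite ltW.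
apply: cvgc_sum => l; apply: cvgM; first exact: cvg_cst.
exact: contour_avg_pole.
Qed.

(** A node value is a Taylor coefficient of order 0 at that node, so the whole functional is a limit
    of averages of one integrand, and a pointwise bound on the circle passes to the limit. *)
Lemma coef_functional_le f a t r0 rho r m n (x : 'I_n -> R) (p : 'I_n -> R[i]) (B : R) :
  -1 <= t <= 1 -> 1 < r < rho -> 0 < r0 -> psum f a t%:C r0 ->
  (forall z, bernstein_ellipse rho z -> analytic_at f z) ->
  (forall j, -1 <= x j <= 1) -> 0 <= B ->
  (forall w, normc w = r -> normc (joukowski_dlog w * (f (joukowski w) *
     ((joukowski w - t%:C) ^- m.+1 -
      \sum_(j < n) p j / (joukowski w - (x j)%:C)))) <= B) ->
  normc (a m - \sum_(j < n) p j * f (x j)%:C) <= B.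
Proof.
move=> t1 /andP[r1 rrho] r00 fa fan x1 B0 hB.
have rg0 : 0 < r by exact: lt_trans r1.
have fx j : contour_avg r (fun z => f z / (z - (x j)%:C) ^+ 1) @ \oo
    --> (f (x j)%:C : R[i]^o).
  have xE : bernstein_ellipse rho (x j)%:C.
    have [v v1 ->] := real_joukowski (x1 j).
    by apply: joukowski_in_bernstein; rewrite v1 lexx (lt_trans r1).
  have [b [rj [rj0 fb]]] := fan _ xE.
  have := psum_derive1n 0 rj0 fb; rewrite derive1n0 mul1r => ->.
  by apply: (contour_avg_coef (rho := rho) _ _ rj0 fb) => //; rewrite r1.
have ft : contour_avg r (fun z => f z / (z - t%:C) ^+ m.+1) @ \oo --> (a m : R[i]^o).
  by apply: (contour_avg_coef (rho := rho) _ _ r00 fa) => //; rewrite r1.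
have lim : (fun N => contour_avg r (fun z => f z / (z - t%:C) ^+ m.+1) N +
    \sum_(j < n) - p j * contour_avg r (fun z => f z / (z - (x j)%:C) ^+ 1) N) @ \oo
    --> (a m + \sum_(j < n) - p j * f (x j)%:C : R[i]^o).
  apply: cvgD; first exact: ft.
  by apply: cvgc_sum => j; apply: cvgM; [exact: cvg_cst|exact: fx].
have -> : a m - \sum_(j < n) p j * f (x j)%:C = a m + \sum_(j < n) - p j * f (x j)%:C.
  by rewrite -sumrN; congr (_ + _); apply: eq_bigr => j _; rewrite mulNr.
apply: cvgc_normc_le lim _; near=> N.
rewrite -contour_avg_sum -contour_avgD normc_cavg_le ?(ltW rg0)// => w wr.
rewrite (le_trans _ (hB w wr))// le_eqVlt; apply/orP; left; apply/eqP; congr (normc (_ * _)).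
rewrite mulrBr mulr_sumr -sumrN; congr (_ + _); apply: eq_bigr => j _.
by rewrite expr1; ring.
Unshelve. all: by end_near. Qed.

End CauchyCoefficients.

(** * Chord lengths and perturbed cosines *)

Section Chords.
Variable R : realType.
Implicit Types (x y t : R) (u v w a : R[i]).

Lemma oneBcos x : 1 - cos x = 2 * sin (x / 2) ^+ 2.
Proof.
rewrite {1}(splitr x) -mulr2n cos_mulr2n cos2sin2 mulrnBl -mulr_natl; ring.
Qed.

Lemma normc_cisB1 x : normc (cis x - 1) = 2 * `|sin (x / 2)|.
Proof.
apply/eqP; rewrite -(@eqrXn2 _ 2) ?mulr_ge0 ?normc_ge0// normc_sqrE /=.
rewrite exprMn real_normK ?num_real//; apply/eqP.
have := oneBcos x; have := cos2Dsin2 x; rewrite subr0 => h1 h2; nra.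
Qed.

Lemma cos2_ge_half y : 0 <= y <= pi / 4 -> 1 / 2 <= cos y ^+ 2.
Proof.
move=> /andP[y0 y4]; have := oneBcos (y *+ 2).
rewrite -(mulr_natl y) mulrAC divff ?mul1r ?pnatr_eq0// => h.
have : 0 <= cos (2 * y).
  by have pi0 := pi_gt0 R; apply: cos_ge0_pihalf; apply/andP; split; lra.
by rewrite cos2sin2; lra.
Qed.

(** With y = x / 2, the mean value theorem gives sin y = y cos c, so sin x = 2 sin y cos y = x cos c
    cos y, and both squared cosines are at least 1/2. *)
Lemma half_le_sin x : 0 <= x <= pi / 2 -> x / 2 <= sin x.
Proof.
move=> /andP[x0 xp]; have [->|xn0] := eqVneq x 0; first by rewrite mul0r sin0.
have pi0 := pi_gt0 R; pose y := x / 2.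
have y0 : 0 < y by rewrite divr_gt0// lt_def xn0.
have y4 : y <= pi / 4 by rewrite /y; lra.
have [|c] := @MVT R sin cos 0 y y0.
  by apply: continuous_subspaceT => ?; exact: continuous_sin.
rewrite in_itv /= => /andP[c0 cy]; rewrite sin0 !subr0 => sy.
have hc : 1 / 2 <= cos c ^+ 2 by apply: cos2_ge_half; apply/andP; split; lra.
have hy : 1 / 2 <= cos y ^+ 2 by apply: cos2_ge_half; apply/andP; split; lra.
have pc : 0 <= cos c by apply: cos_ge0_pihalf; apply/andP; split; lra.
have py : 0 <= cos y by apply: cos_ge0_pihalf; apply/andP; split; lra.
have cc : 1 / 2 <= cos c * cos y.
  rewrite -(@ler_pXn2r _ 2) ?nnegrE ?mulr_ge0// [leRHS]exprMn [leLHS]expr2.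
  by rewrite ler_pM.
rewrite (splitr x) -/y -mulr2n sin_mulr2n sy mulr2n.
have := ler_wpM2r (ltW y0) cc; lra.
Qed.

Lemma normc_cisB1_ge x : `|x| <= pi -> `|x| / 2 <= normc (cis x - 1).
Proof.
move=> xpi; rewrite normc_cisB1.
have -> : `|sin (x / 2)| = `|sin (`|x| / 2)|.
  by have [x0|x0] := ger0P x; rewrite // mulNr sinN normrN.
have h : `|x| / 2 / 2 <= sin (`|x| / 2).
  by apply: half_le_sin; rewrite divr_ge0//= ler_wpM2r ?invr_ge0.
have h0 : 0 <= `|x| / 2 / 2 by rewrite !divr_ge0.
have -> : `|sin (`|x| / 2)| = sin (`|x| / 2) by rewrite ger0_norm ?(le_trans h0 h).
lra.
Qed.

(** The squared moduli differ by (x - 1) (x + 1 - 2 s), where s <= 1 is the real scalar product of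
    the unit vectors [v] and [a]. *)
Lemma normc_scale_ge v a x : normc v = 1 -> normc a = 1 -> 1 <= x ->
  normc (v - a) <= normc (x%:C * v - a).
Proof.
move=> v1 a1 x1; rewrite -(@ler_pXn2r _ 2) ?nnegrE ?normc_ge0//.
have := normc_sqrE v; have := normc_sqrE a; rewrite v1 a1 !normc_sqrE.
case: v {v1} => p q; case: a {a1} => c s; rewrite /= => ha hv.
have : p * c + q * s <= 1 by have := sqr_ge0 (p - c); have := sqr_ge0 (q - s); nra.
nra.
Qed.

(** For [a] on the unit circle the conjugate is [a^-1]: of the two factors of a Chebyshev distance,
    the one with [a^-1] is the larger in the upper half-plane. *)
Lemma normc_conj_ge w a : 0 <= complex.Im w -> 0 <= complex.Im a ->
  normc (w - a) <= normc (w - a^*%C).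
Proof.
move=> w0 a0; rewrite -(@ler_pXn2r _ 2) ?nnegrE ?normc_ge0// !normc_sqrE.
by case: w w0 => p q /= q0; case: a a0 => c s /= s0; nra.
Qed.

Lemma normc_conj_ge_Im w a : 0 <= complex.Im w -> 0 <= complex.Im a ->
  complex.Im a <= normc (w - a^*%C).
Proof.
move=> w0 a0; apply: le_trans (le_Im_normc _).
case: w w0 => p q /= q0; case: a a0 => c s /= s0; rewrite opprK ger0_norm ?addr_ge0//.
by rewrite lerDr.
Qed.

Lemma conj_cis x : (cis x)^*%C = (cis x)^-1.
Proof. by rewrite -cisN /cis /= cosN sinN. Qed.

(** The factor |sin x| is kept: near the ends of [-1, 1] the nodes are O(1/n^2) apart, and a bound
    by |y| alone would be too coarse there. *)
Lemma cosD_dist x y : `|cos (x + y) - cos x| <= `|sin x| * `|y| + y ^+ 2 / 2.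
Proof.
have -> : cos (x + y) - cos x = - (sin x * sin y) - cos x * (1 - cos y).
  by rewrite cosD; ring.
apply: le_trans (ler_normB _ _) _; rewrite normrN !normrM lerD//.
  by rewrite ler_wpM2l// ler_norm_sin.
rewrite oneBcos; apply: (@le_trans _ _ (1 * `|2 * sin (y / 2) ^+ 2|)).
  by rewrite ler_wpM2r// cos_max.
rewrite mul1r normrM normrX ger0_norm// .
have : `|sin (y / 2)| ^+ 2 <= `|y / 2| ^+ 2.
  by rewrite lerXn2r ?nnegrE// ler_norm_sin.
by rewrite real_normK ?num_real// real_normK ?num_real// expr_div_n; lra.
Qed.

End Chords.

(** * Sums of inverse distances *)

Section RealSums.
Variable R : realType.

Lemma sum_inv_le n : (0 < n)%N ->
  \sum_(0 <= k < n.+1) (k.+1%:R)^-1 <= 2 * (1 + ln n%:R) :> R.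
Proof.
(* There are n + 1 terms; the last one is at most 1 and is absorbed by the factor 2. The induction
   below rests on 1 / (n + 2) <= ln ((n + 2) / (n + 1)). *)
move=> n0; suff h : \sum_(0 <= k < n) (k.+1%:R)^-1 <= 1 + ln n%:R :> R.
  rewrite big_nat_recr//=.
  have : (n.+1%:R)^-1 <= 1 :> R by rewrite invf_le1 ?ltr0n// ler1n.
  have : 0 <= ln (n%:R : R) by rewrite ln_ge0// ler1n.
  by set b := n.+1%:R^-1; lra.
case: n n0 => // n _; elim: n => [|n IH].
  by rewrite big_nat1 invr1 ln1 addr0.
rewrite big_nat_recr//= (le_trans (lerD IH (lexx _)))// -addrA lerD2l.
have p1 : 0 < n.+1%:R :> R by rewrite ltr0n.
have p2 : 0 < n.+2%:R :> R by rewrite ltr0n.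
have i1 : n.+2%:R^-1 < 1 :> R by rewrite invf_lt1// ltr1n.
have := @le_ln1Dx R (- n.+2%:R^-1).
have -> : 1 + - n.+2%:R^-1 = n.+1%:R / n.+2%:R :> R.
  by apply: (mulIf (lt0r_neq0 p2)); rewrite divfK ?gt_eqF// mulrDl mulNr mulVf ?gt_eqF// -(natr1 n.+1); ring.
rewrite ln_div ?posrE// => h; have : -1 < - n.+2%:R^-1 :> R by rewrite ltrN2.
by move=> /h; set b := n.+2%:R^-1; lra.
Qed.

Lemma sum_inv_sq_le n : \sum_(0 <= k < n) (k.+1%:R)^-1 ^+ 2 <= 2 :> R.
Proof.
case: n => [|n]; first by rewrite big_geq.
(* The subtracted inverse makes the induction close, since 1 / (n + 2)^2 <= 1 / (n + 1) - 1 / (n +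
   2). *)
suff h : \sum_(0 <= k < n.+1) (k.+1%:R)^-1 ^+ 2 <= 2 - (n.+1%:R)^-1 :> R.
  by rewrite (le_trans h)// lerBlDr lerDl invr_ge0.
elim: n => [|n IH]; first by rewrite big_nat1 invr1 expr1n; lra.
rewrite big_nat_recr//= (le_trans (lerD IH (lexx _)))//.
set a : R := n.+1%:R; have a0 : 0 < a by rewrite ltr0n.
rewrite -(natr1 n.+1) -/a -subr_ge0.
have -> : 2 - (a + 1)^-1 - (2 - a^-1 + (a + 1)^-1 ^+ 2) = (a * (a + 1) ^+ 2)^-1.
  by field; rewrite !gt_eqF// addr_gt0.
by rewrite invr_ge0 mulr_ge0 ?exprn_ge0 ?addr_ge0// ltW.
Qed.

(** By truncated subtraction the argument of [F] is |j - J|, and each distance is attained at most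
    twice. *)
Lemma sum_dist_le (F : nat -> R) n J : (J <= n)%N -> (forall k, 0 <= F k) ->
  \sum_(j < n.+1) F ((j - J) + (J - j))%N <= 2 * \sum_(0 <= k < n.+1) F k.
Proof.
move=> Jn F0; rewrite -(big_mkord xpredT (fun j => F ((j - J) + (J - j))%N)).
have mono k l : (k <= l)%N -> \sum_(0 <= i < k) F i <= \sum_(0 <= i < l) F i.
  by move=> kl; rewrite (big_cat_nat (leq0n k) kl) lerDl sumr_ge0.
rewrite (big_cat_nat (leq0n J) (leqW Jn)) mulr2n mulrDl !mul1r lerD//.
  have /mono : (J.+1 <= n.+1)%N by [].
  apply: le_trans; rewrite big_nat_rev /= [leRHS]big_nat_recl//=.
  rewrite (eq_big_nat _ _ (F2 := fun i => F i.+1)) ?lerDr// => i /andP[_ iJ].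
  by congr F; lia.
rewrite (_ : \sum_(J <= j < n.+1) F (j - J + (J - j))%N = \sum_(0 <= k < n.+1 - J) F k).
  by apply: mono; lia.
transitivity (\sum_(0 + J <= j < n.+1) F (j - J + (J - j))%N); first by [].
by rewrite big_addn; apply: eq_bigr => j _; congr F; lia.
Qed.

End RealSums.

(** * The Chebyshev product through the 2n-th roots of unity *)

Lemma prod_subX_prim (F : fieldType) N (z w : F) : N.-primitive_root z ->
  \prod_(0 <= i < N) (w - z ^+ i) = w ^+ N - 1.
Proof.
move=> /factor_Xn_sub_1 /(congr1 (fun p : {poly F} => p.[w])).
rewrite horner_prod !hornerE => <-.
by apply: eq_bigr => i _; rewrite hornerXsubC.
Qed.

Section Nodes.
Variable R : realType.

Definition cheb_root (n j : nat) : R[i] := cis (j%:R * pi / n%:R).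

Lemma cheb_rootE n j : cheb_root n j = cis (pi / n%:R) ^+ j.
Proof. by rewrite cisX mulrA. Qed.

(** An order m < 2 n would force cos (m pi / n) = 1, against 1 - cos (m pi / n) = 2 sin (m pi / (2
    n))^2 > 0. *)
Lemma primitive_cheb_root n : (0 < n)%N ->
  (2 * n)%N.-primitive_root (cis (pi / n%:R) : R[i]).
Proof.
move=> n0; set z := cis _; have nR : n%:R != 0 :> R by rewrite pnatr_eq0 -lt0n.
have zk k : z ^+ k = cis (k%:R * (pi / n%:R)) by rewrite cisX.
have z2n : z ^+ (2 * n)%N = 1.
  rewrite zk (_ : _ * _ = pi *+ 2); first by rewrite /cis cos2pi sin2pi.
  by rewrite natrM; field.
have n20 : (0 < 2 * n)%N by rewrite muln_gt0.
have [m /[dup] zm /prim_expr_order zm1 md] := prim_order_exists n20 z2n.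
have m0 : (0 < m)%N by exact: prim_order_gt0 zm.
have mle : (m <= 2 * n)%N by exact: dvdn_leq.
suff <- : m = (2 * n)%N by [].
apply/eqP; rewrite eqn_leq mle leqNgt; apply/negP => mlt.
have pi0 := pi_gt0 R.
have s0 : 0 < sin (m%:R * (pi / n%:R) / 2) :> R.
  apply: sin_gt0_pi; rewrite !divr_gt0 ?mulr_gt0 ?divr_gt0 ?invr_gt0 ?ltr0n//=.
  rewrite (_ : _ / 2 = pi * (m%:R / (2 * n)%:R)); last by rewrite natrM; field.
  by rewrite gtr_pMr// ltr_pdivrMr ?ltr0n// mul1r ltr_nat.
have := @oneBcos R (m%:R * (pi / n%:R)).
have -> : cos (m%:R * (pi / n%:R)) = 1 :> R.
  by move: zm1; rewrite zk => /(congr1 (@complex.Re R)).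
by move=> h; have := exprn_gt0 2 s0; lra.
Qed.

(** The roots and their inverses run through all 2n-th roots of unity; 1 (j = 0) and -1 (j = n) are
    their own inverses and occur twice, whence the extra w^2 - 1. *)
Lemma prod_cheb_root n (w : R[i]) : (0 < n)%N ->
  \prod_(j < n.+1) ((w - cheb_root n j) * (w - (cheb_root n j)^-1)) =
  (w ^+ (2 * n) - 1) * (w ^+ 2 - 1).
Proof.
move=> n0; pose z : R[i] := cis (pi / n%:R).
have zn : z ^+ n = -1.
  rewrite cisX mulrC divfK ?pnatr_eq0 -?lt0n// /cis cospi sinpi.
  by apply/eqP; rewrite eq_complex /= oppr0 !eqxx.
have E := prod_subX_prim w (primitive_cheb_root n0 : (2 * n)%N.-primitive_root z).
under eq_bigr do rewrite cheb_rootE -/z.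
rewrite big_split /= -E; have -> : (2 * n = n.+1 + n.-1)%N by lia.
rewrite (big_cat_nat (leq0n n.+1) (leq_addr n.-1 n.+1)) /=.
rewrite big_mkord.
rewrite -mulrA; congr (_ * _).
rewrite -(big_mkord xpredT (fun j => w - (z ^+ j)^-1)).
rewrite big_nat_recl//= expr0 invr1.
case: n n0 @z zn E => // n _ z zn E.
rewrite big_nat_recr//= zn invrN1 opprK.
set P := \prod_(0 <= i < n) _; set Q := \prod_(_ <= i < _) _.
suff -> : P = Q by ring.
transitivity (\prod_(0 + n.+2 <= i < n.+2 + n) (w - z ^+ i)); last by [].
rewrite /P big_addn addKn [RHS]big_nat_rev /=.
apply: eq_big_nat => i /andP[_ iN]; congr (_ - _).
apply: (mulIf (_ : z ^+ i.+1 != 0)); first by rewrite expf_neq0// cis_neq0.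
rewrite mulVf ?expf_neq0 ?cis_neq0// -exprD.
rewrite (_ : (_ + i.+1)%N = (n.+1 + n.+1)%N); last by move: iN; clear; lia.
by rewrite exprD zn mulrNN mulr1.
Qed.

End Nodes.

(** * Nodal products at the perturbed nodes *)

Lemma natr_dist (K : realDomainType) (j k : nat) :
  `|j%:R - k%:R| = ((j - k) + (k - j))%N%:R :> K.
Proof.
case: (leqP j k) => jk.
  rewrite (eqP (_ : (j - k == 0)%N)) ?subn_eq0// add0n.
  by rewrite distrC natrB// ger0_norm// subr_ge0 ler_nat.
rewrite (eqP (_ : (k - j == 0)%N)) ?subn_eq0 ?(ltnW jk)// addn0.
by rewrite natrB ?(ltnW jk)// ger0_norm// subr_ge0 ler_nat ltnW.
Qed.

Lemma leq_dist (j k n : nat) : (j <= n)%N -> (k <= n)%N -> ((j - k) + (k - j) <= n)%N.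
Proof. lia. Qed.

Section NodeProducts.
Variable R : realType.
Variables (n : nat) (n_gt0 : (0 < n)%N) (eps : 'I_n.+1 -> R) (sigma : R).
Hypothesis eps_le : forall j, `|eps j| <= sigma.

Let a (j : nat) : R[i] := cheb_root R n j.
Let theta (j : nat) : R := j%:R * pi / n%:R.
Let x := perturbed_node eps.

Let nR0 : 0 < n%:R :> R.
Proof. by rewrite ltr0n. Qed.

Let sigma_ge0 : 0 <= sigma.
Proof. exact: le_trans (normr_ge0 _) (eps_le ord0). Qed.

Let normc_a j : normc (a j) = 1.
Proof. exact: normc_cis. Qed.

Let a_neq0 j : a j != 0.
Proof. exact: cis_neq0. Qed.

Let joukowski_a j : joukowski (a j) = (cos (theta j))%:C.
Proof. exact: joukowski_cis. Qed.

Lemma perturbed_node_itv j : -1 <= x j <= 1.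
Proof. by rewrite cos_geN1 cos_le1. Qed.

Let node_deviation (j : 'I_n.+1) :
  `|x j - cos (theta j)| <= `|sin (theta j)| * sigma + sigma ^+ 2 / 2.
Proof.
apply: le_trans (cosD_dist _ _) _; rewrite lerD ?ler_wpM2l// ler_wpM2r ?invr_ge0//.
by rewrite -(@real_normK _ (eps j)) ?num_real// lerXn2r ?nnegrE.
Qed.

Let normc_prod_a (w : R[i]) :
  \prod_(j < n.+1) (normc (w - a j) * normc (w - (a j)^-1)) =
  normc (w ^+ (2 * n) - 1) * normc (w ^+ 2 - 1).
Proof.
rewrite -normcM -prod_cheb_root// normc_prod.
by apply: eq_bigr => j _; rewrite normcM.
Qed.

(** Each factor is at least d > 0, so moving a node changes it by a relative amount of at most 2
    sigma / d, hence by a factor of at most exp (2 sigma / d). The n + 1 factors together cost exp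
    (8 r / (r - 1)^2), because (n + 1) sigma <= 2. *)
Lemma prod_node_ge (w : R[i]) (r : R) : n%:R * sigma <= 1 -> 1 < r -> normc w = r ->
  expR (- (8 * r / (r - 1) ^+ 2)) * ((r ^+ 2 - 1) ^+ 2 / (2 * r ^+ 3)) * (r / 2) ^+ n
  <= \prod_(j < n.+1) normc (joukowski w - (x j)%:C).
Proof.
move=> ns r1 wr; have r0 : 0 < r by exact: lt_trans r1.
have w0 : w != 0 by rewrite -normc_gt0 wr.
pose d := (r - 1) ^+ 2 / (2 * r).
have r10 : 0 < r - 1 by rewrite subr_gt0.
have d0 : 0 < d by rewrite divr_gt0 ?exprn_gt0 ?mulr_gt0.
have dx j : d <= normc (joukowski w - (x j)%:C).
  by rewrite /d -wr; apply: joukowski_dist; rewrite ?wr// perturbed_node_itv.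
have s1 : sigma <= 1.
  by apply: le_trans ns; rewrite ler_peMl// ler1n.
pose P0 := \prod_(j < n.+1) normc (joukowski w - (cos (theta j))%:C).
have P0E : P0 = normc (w ^+ (2 * n) - 1) * normc (w ^+ 2 - 1) / (2 * r) ^+ n.+1.
  rewrite -normc_prod_a -[in (2 * r) ^+ _](card_ord n.+1) -prodr_const.
  rewrite -prodf_div; apply: eq_bigr => j _.
  by rewrite -joukowski_a joukowskiB// !normcM normcV normcM (normc_nat _ 2) wr.
have P0ge : (r ^+ 2 - 1) ^+ 2 / (2 * r ^+ 3) * (r / 2) ^+ n <= P0.
  have r2 : 0 <= r ^+ 2 - 1 by rewrite subr_ge0 exprn_ege1// ltW.
  (* As r^(2n-2) >= 1, lowering r^(2n) - 1 to (r^2 - 1) r^(2n-2) leaves a pure power of r to set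
     against (2 r)^(n+1). *)
  have e1 : (r ^+ 2 - 1) * r ^+ (2 * n.-1) <= normc (w ^+ (2 * n) - 1).
    apply: le_trans (lerB_normc _ _); rewrite normcX normc1 wr.
    rewrite -{2}(prednK n_gt0) mulnS exprD mulrBl lerD2l lerN2 mul1r.
    by rewrite exprn_ege1// ltW.
  have e2 : r ^+ 2 - 1 <= normc (w ^+ 2 - 1).
    by apply: le_trans (lerB_normc _ _); rewrite normcX normc1 wr.
  rewrite P0E ler_pdivlMr ?exprn_gt0 ?mulr_gt0//.
  apply: le_trans (ler_pM _ _ e1 e2) => //; last by rewrite mulr_ge0// exprn_ge0// ltW.
  rewrite le_eqVlt; apply/orP; left; apply/eqP.
  rewrite -{1 2}(prednK n_gt0); move: n.-1 => k.
  have := exprn_gt0 k r0; have : 0 < 2 ^+ k :> R by rewrite exprn_gt0.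
  rewrite mul2n -addnn exprD (exprS (r / 2)) expr_div_n (exprMn _ 2 r).
  rewrite (exprS 2 k.+1) (exprS 2 k) (exprS r k.+1) (exprS r k).
  move: (2 ^+ k) (r ^+ k) => A B A0 B0.
  by field; rewrite !gt_eqF.
have P0le : P0 <= (\prod_(j < n.+1) normc (joukowski w - (x j)%:C)) *
    expR (8 * r / (r - 1) ^+ 2).
  apply: (@le_trans _ _ (\prod_(j < n.+1) (normc (joukowski w - (x j)%:C) *
     expR (2 * sigma / d)))).
    apply: ler_prod => j _; rewrite normc_ge0 /=.
    apply: (@le_trans _ _ (normc (joukowski w - (x j)%:C) * (1 + 2 * sigma / d))); last first.
      by rewrite ler_wpM2l ?normc_ge0// expR_ge1Dx.
    have -> : joukowski w - (cos (theta j))%:C =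
      (joukowski w - (x j)%:C) + (x j - cos (theta j))%:C by rewrite rmorphB /=; ring.
    apply: le_trans (le_normcD _ _) _; rewrite normc_real mulrDr mulr1 lerD2l.
    apply: (@le_trans _ _ (d * (2 * sigma / d))); last first.
      by apply: ler_wpM2r => //; apply: divr_ge0; rewrite ?(ltW d0)// mulr_ge0.
    rewrite mulrC divfK ?gt_eqF//; apply: le_trans (node_deviation j) _.
    have s2 : sigma ^+ 2 <= sigma by rewrite expr2 ler_piMl.
    have : `|sin (theta j)| * sigma <= sigma by rewrite ler_piMl// sin_max.
    by move: sigma_ge0 s2; lra.
  rewrite big_split /= prodr_const card_ord -expRM_natl ler_wpM2l//.
    by apply: prodr_ge0 => j _; exact: normc_ge0.
  rewrite ler_expR /d invf_div.
  have -> : n.+1%:R * (2 * sigma * (2 * r / (r - 1) ^+ 2)) =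
     (n.+1%:R * sigma / 2) * (8 * r / (r - 1) ^+ 2).
    by field; rewrite gt_eqF.
  rewrite ler_piMl ?divr_ge0 ?mulr_ge0 ?exprn_ge0 ?(ltW r0) ?(ltW r10)//.
  by rewrite -natr1 mulrDl mul1r; lra.
rewrite -mulrA expRN ler_pdivrMl ?expR_gt0//.
by rewrite [leRHS]mulrC; exact: le_trans P0ge P0le.
Qed.

(* With t = joukowski v and |v| = 1, replacing v by w = (1 + 1/n) v changes the
   Chebyshev product by a bounded factor and gives
   3 |w - a j| >= (1 + |j - J|) / n, where a J is closest to v.  The relative
   perturbations then add up to at most 24 n sigma (1 + ln n) + 144 <= 168. *)
Lemma prod_node_le (t : R) : n%:R * sigma * (ln n%:R + 1) <= 1 -> -1 <= t <= 1 ->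
  \prod_(j < n.+1) (`|t - x j| + n%:R^-1 ^+ 2) <=
  (expR 2 + 1) * 5 * expR 168 / 2 ^+ n.
Proof.
move=> ns t1.
have ln0 : 0 <= ln n%:R :> R by rewrite ln_ge0// ler1n.
have ns1 : n%:R * sigma <= 1.
  by apply: le_trans ns; rewrite ler_peMr ?mulr_ge0 ?(ltW nR0)// lerDr.
have sn : sigma <= n%:R^-1 by rewrite -[leRHS]mulr1 ler_pdivlMl.
pose v := cis (acos t); have v1 : normc v = 1 := normc_cis _.
have vt : joukowski v = t%:C by rewrite joukowski_cis acosK.
have Imv : 0 <= complex.Im v by apply: sin_ge0_pi; rewrite acos_ge0 ?acos_lepi.
pose rn : R := 1 + n%:R^-1; have ni0 : 0 < n%:R^-1 :> R by rewrite invr_gt0.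
have rn1 : 1 <= rn by rewrite lerDl ltW.
pose w := rn%:C * v.
have nw : normc w = rn by rewrite normcM v1 mulr1 normc_real ger0_norm// (le_trans _ rn1).
have Imw : 0 <= complex.Im w.
  rewrite /w; case: (v) Imv => p q /= q0; rewrite mul0r addr0 mulr_ge0//.
  by rewrite (le_trans _ rn1).
have Ima j : (j < n.+1)%N -> 0 <= complex.Im (a j).
  move=> jn; apply: sin_ge0_pi; have pi0 := pi_gt0 R.
  rewrite divr_ge0 ?mulr_ge0 ?(ltW pi0)//= ler_pdivrMr// mulrC ler_wpM2l ?(ltW pi0)//.
  by rewrite ler_nat -ltnS.
have [J hJ] : exists J : 'I_n.+1, forall j : 'I_n.+1, normc (v - a J) <= normc (v - a j).
  case: (@arg_minP _ _ _ ord0 xpredT (fun j : 'I_n.+1 => normc (v - a j)) isT) => J _ hJ.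
  by exists J => j; exact: hJ.
pose dist (j : nat) := ((j - J) + (J - j))%N.
(* The 3 is 1 + 2: one |w - a j| pays for 1 / n, the radial gap; two more pay for |a j - a J| <= 2
   |v - a j|, as [J] is closest, and this chord is at least |j - J| / n. *)
have hX (j : 'I_n.+1) : (dist j).+1%:R / n%:R <= 3 * normc (w - a j).
  have h1 : n%:R^-1 <= normc (w - a j).
    by apply: le_trans (lerB_normc _ _); rewrite nw normc_a /rn addrAC subrr add0r.
  have h2 : normc (v - a j) <= normc (w - a j) by exact: normc_scale_ge.
  have h3 : (dist j)%:R / n%:R <= normc (a j - a J).
    have -> : a j - a J = a J * (cis (theta j - theta J) - 1).
      by rewrite mulrBr mulr1; congr (_ - _); rewrite /a /cheb_root -cisD addrC subrK.
    have thE : `|theta j - theta J| = (dist j)%:R * (pi / n%:R).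
      rewrite /theta -!mulrA -mulrBl normrM [X in _ * X]ger0_norm; last first.
        by rewrite divr_ge0// pi_ge0.
      by rewrite natr_dist.
    rewrite normcM normc_a mul1r; apply: le_trans (normc_cisB1_ge _).
      have -> : `|theta j - theta J| / 2 = (dist j)%:R / n%:R * (pi / 2).
        by rewrite thE; ring.
      by rewrite ler_peMr ?divr_ge0// ?(ltW nR0)// ler_pdivlMr// mul1r pi_ge2.
    rewrite thE mulrCA ler_piMr ?pi_ge0// ler_pdivrMr// mul1r ler_nat.
    exact: leq_dist (leq_ord j) (leq_ord J).
  have h4 : normc (a j - a J) <= 2 * normc (v - a j).
    have -> : a j - a J = (v - a J) - (v - a j) by ring.
    by apply: le_trans (le_normcB _ _) _; have := hJ j; lra.
  by rewrite -natr1 mulrDl mul1r; lra.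
pose A j := normc (w - a j) * normc (w - (a j)^-1) / 2.
(* The first term absorbs |sin theta_j| sigma, the second both sigma^2 / 2 and the added 1/n^2. With
   q = 1 / (1 + |j - J|), both follow from 3 n q |w - a j| >= 1, where the factor with the inverse
   root dominates |w - a j| and |sin theta_j|. *)
pose e j := 6 * (n%:R * sigma) * (dist j).+1%:R^-1 + 36 * (dist j).+1%:R^-1 ^+ 2 : R.
have A0 j : 0 <= A j by rewrite divr_ge0 ?mulr_ge0 ?normc_ge0.
apply: (@le_trans _ _ (\prod_(j < n.+1) (A j * expR (e j)))).
  apply: ler_prod => j _; rewrite addr_ge0 ?exprn_ge0 ?(ltW ni0)//=.
  apply: (@le_trans _ _ (A j * (1 + e j))); last by rewrite ler_wpM2l// expR_ge1Dx.
  have tx : `|t - cos (theta j)| <= A j.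
    have tE : (t - cos (theta j))%:C = joukowski v - joukowski (a j).
      by rewrite vt joukowski_a rmorphB.
    rewrite -normc_real tE joukowskiB ?cis_neq0//.
    rewrite normcM normcV !normcM v1 (normc_nat _ 2) mulr1 ler_wpM2r ?invr_ge0//.
    by rewrite ler_pM ?normc_ge0// normc_scale_ge// normcV normc_a invr1.
  have -> : t - x j = (t - cos (theta j)) - (x j - cos (theta j)) by ring.
  rewrite mulrDr mulr1.
  apply: (@le_trans _ _ (A j + (`|sin (theta j)| * sigma + sigma ^+ 2 / 2) + n%:R^-1 ^+ 2)).
    by rewrite lerD2r; apply: le_trans (ler_normB _ _) _; rewrite lerD.
  rewrite -addrA lerD2l.
  have Imaj := Ima j (ltn_ord j).
  have := hX j; set X := normc (w - a j) => hXj.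
  have X0 : 0 <= X by exact: normc_ge0.
  pose Y := normc (w - (a j)^-1).
  have XY : X <= Y by rewrite /Y -conj_cis; exact: normc_conj_ge.
  have sY : `|sin (theta j)| <= Y.
    by have := normc_conj_ge_Im Imw Imaj; rewrite ger0_norm// /Y -conj_cis.
  pose q : R := (dist j).+1%:R^-1; have q0 : 0 < q by rewrite invr_gt0 ltr0n.
  have h1 : 1 <= 3 * n%:R * q * X.
    have -> : 3 * n%:R * q * X = (3 * X) * n%:R * q by ring.
    by rewrite /q ler_pdivlMr ?ltr0n// mul1r -ler_pdivrMr.
  have s2 : sigma ^+ 2 <= n%:R^-1 ^+ 2 by rewrite lerXn2r ?nnegrE ?(ltW ni0).
  have h2 : `|sin (theta j)| * sigma <= A j * (6 * (n%:R * sigma) * q).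
    have -> : A j * (6 * (n%:R * sigma) * q) = (3 * n%:R * q * X) * Y * sigma.
      by rewrite /A -/X -/Y; field.
    rewrite ler_wpM2r//; apply: (le_trans sY).
    by rewrite ler_peMl// normc_ge0.
  have h3 : 2 * n%:R^-1 ^+ 2 <= A j * (36 * q ^+ 2).
    have -> : A j * (36 * q ^+ 2) = 18 * q ^+ 2 * X * Y by rewrite /A -/X -/Y; field.
    apply: (@le_trans _ _ (18 * q ^+ 2 * X * X)); last first.
      by rewrite ler_wpM2l// !mulr_ge0// ltW.
    have -> : 18 * q ^+ 2 * X * X = 2 * n%:R^-1 ^+ 2 * (3 * n%:R * q * X) ^+ 2.
      by field; rewrite gt_eqF.
    by rewrite ler_peMr ?mulr_ge0 ?exprn_ge0 ?(ltW ni0)// exprn_ege1.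
  rewrite /e -/q mulrDr.
  have : 0 <= n%:R^-1 ^+ 2 :> R by rewrite exprn_ge0// ltW.
  by move: h2 h3 s2; lra.
rewrite big_split /= -expR_sum.
have se : \sum_(j < n.+1) e j <= 168.
  rewrite big_split /= -!mulr_sumr.
  have Jn : (J <= n)%N by rewrite -ltnS.
  have i0 k : 0 <= (k.+1%:R : R)^-1 by rewrite invr_ge0.
  have := sum_dist_le (F := fun k => (k.+1%:R : R)^-1) Jn i0.
  have := sum_dist_le (F := fun k => (k.+1%:R : R)^-1 ^+ 2) Jn (fun k => exprn_ge0 2 (i0 k)).
  have := sum_inv_le R n_gt0; have := sum_inv_sq_le R n.+1.
  set S1 := \sum_(0 <= _ < _) _; set S2 := \sum_(0 <= _ < _) _.
  set T1 := \sum_(_ < _) _; set T2 := \sum_(_ < _) _ => a1 a2 a3 a4.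
  have : 6 * (n%:R * sigma) * T2 <= 6 * (n%:R * sigma) * (4 * (1 + ln n%:R)).
    by rewrite ler_wpM2l ?mulr_ge0 ?(ltW nR0)//; lra.
  have -> : 6 * (n%:R * sigma) * (4 * (1 + ln n%:R)) =
     24 * (n%:R * sigma * (ln n%:R + 1)) by ring.
  by lra.
have pA : \prod_(j < n.+1) A j <= (expR 2 + 1) * 5 / 2 ^+ n.
  have -> : \prod_(j < n.+1) A j =
      normc (w ^+ (2 * n) - 1) * normc (w ^+ 2 - 1) / 2 ^+ n.+1.
    by rewrite -normc_prod_a -[in 2 ^+ _](card_ord n.+1) -prodr_const -prodf_div.
  have b1 : normc (w ^+ (2 * n) - 1) <= expR 2 + 1.
    apply: le_trans (le_normcB _ _) _; rewrite normc1 lerD2r normcX nw.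
    have -> : expR 2 = expR n%:R^-1 ^+ (2 * n) :> R.
      by rewrite -expRM_natl natrM -mulrA divff ?mulr1// gt_eqF.
    by rewrite lerXn2r ?nnegrE ?expR_ge0 ?expR_ge1Dx// (le_trans _ rn1).
  have b2 : normc (w ^+ 2 - 1) <= 5.
    apply: le_trans (le_normcB _ _) _; rewrite normc1 normcX nw.
    have : rn <= 2 by rewrite /rn (_ : 2 = 1 + 1)// lerD2l invf_le1// ler1n.
    have : 0 <= rn by rewrite (le_trans _ rn1).
    by nra.
  apply: ler_pM; rewrite ?mulr_ge0 ?normc_ge0 ?invr_ge0 ?exprn_ge0//.
    by rewrite ler_pM ?normc_ge0.
  by rewrite lef_pV2 ?posrE ?exprn_gt0// exprS ler_peMl ?exprn_ge0// ler1n.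
rewrite [leRHS](_ : _ = (expR 2 + 1) * 5 / 2 ^+ n * expR 168); last by ring.
by apply: ler_pM; rewrite ?expR_ge0 ?prodr_ge0 ?ler_expR.
Qed.

End NodeProducts.

(** * Polynomial identities for interpolating a pole *)

Section PolynomialIdentities.
Variable F : fieldType.
Implicit Types (p : {poly F}) (t y z : F).

(** [nderivn] is the derivative divided by a factorial, so its values are Taylor coefficients and
    the Leibniz rule carries no binomial weight. *)
Lemma horner_nderivn_mulXsubC p y t l :
  ((p * ('X - y%:P))^`N(l.+1)).[t] = (t - y) * (p^`N(l.+1)).[t] + (p^`N(l)).[t].
Proof.
have -> : p * ('X - y%:P) = (p * 'X + 0%:P) - y *: p.
  by rewrite polyC0 addr0 mulrBr [p * y%:P]mulrC mul_polyC.
by rewrite nderivnB nderivnMXaddC nderivnZ !hornerE; ring.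
Qed.

(** The sum interpolates 1 / (z - X). Hence the left side vanishes at the n + 1 nodes and equals 1
    at z, as the right side does; the difference has n + 2 roots and size at most n + 2. *)
Lemma interp_pole n (y : 'I_n.+1 -> F) (L : 'I_n.+1 -> {poly F}) z :
  injective y -> (forall j, size (L j) <= n.+1)%N ->
  (forall i j, (L j).[y i] = (i == j)%:R) -> (forall j, z != y j) ->
  let omega := \prod_(j < n.+1) ('X - (y j)%:P) in
  (\sum_(j < n.+1) (z - y j)^-1 *: L j) * ('X - z%:P) + 1 =
  (omega.[z])^-1 *: omega.
Proof.
move=> yinj sL hL zy omega; set P := \sum_(j < n.+1) _.
have o0 : omega.[z] != 0.
  rewrite horner_prod; apply/prodf_neq0 => j _.
  by rewrite hornerXsubC subr_eq0.
apply/eqP; rewrite -subr_eq0; apply/eqP.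
have so : size omega = n.+2.
  by rewrite size_prod_XsubC /index_enum -enumT size_enum_ord.
apply: (@roots_geq_poly_eq0 _ _ (z :: map y (enum 'I_n.+1))).
- rewrite /= rootE !hornerE subrr mulr0 add0r mulVf// subrr eqxx /=.
  apply/allP => _ /mapP[i _ ->].
  have oi : omega.[y i] = 0.
    by rewrite horner_prod (bigD1 i) //= hornerXsubC subrr mul0r.
  rewrite rootE hornerD hornerN hornerZ oi mulr0 subr0 hornerD hornerM hornerXsubC hornerC.
  rewrite horner_sum (bigD1 i) //= big1 => [|j ji].
    rewrite addr0 hornerZ hL eqxx mulr1 -[y i - z]opprB mulrN mulVf ?subr_eq0//.
    by rewrite addNr.
  by rewrite hornerZ hL eq_sym (negbTE ji) mulr0.
- rewrite /= map_inj_uniq// enum_uniq andbT; apply/mapP => -[j _ /eqP].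
  by rewrite (negbTE (zy j)).
rewrite /= size_map size_enum_ord.
apply: leq_trans (size_polyD _ _) _; rewrite geq_max size_polyN.
rewrite (leq_trans (size_scale_leq _ _)) ?so// andbT.
apply: leq_trans (size_polyD _ _) _; rewrite geq_max size_poly1 andbT.
apply: leq_trans (size_polyMleq _ _) _; rewrite size_XsubC addn2 /= ltnS.
apply: leq_trans (size_sum _ _ _) _; apply/bigmax_leqP => j _.
exact: leq_trans (size_scale_leq _ _) _.
Qed.

(* q k is the k-th Taylor coefficient at t of the error made in interpolating
   the function (z - .)^-1. *)
Lemma interp_pole_coef n (y : 'I_n.+1 -> F) (L : 'I_n.+1 -> {poly F}) z t l :
  injective y -> (forall j, size (L j) <= n.+1)%N ->
  (forall i j, (L j).[y i] = (i == j)%:R) -> (forall j, z != y j) -> z != t ->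
  let omega := \prod_(j < n.+1) ('X - (y j)%:P) in
  let q k := (z - t) ^- k.+1 - \sum_(j < n.+1) (L j)^`N(k).[t] / (z - y j) in
  (z - t) * q l = (if l is k.+1 then q k else 0) + (omega.[z])^-1 * (omega^`N(l)).[t].
Proof.
move=> yinj sL hL zy zt omega q; set c := (omega.[z])^-1.
have zt0 : z - t != 0 by rewrite subr_eq0.
pose P := \sum_(j < n.+1) (z - y j)^-1 *: L j.
have PE k : (P^`N(k)).[t] = \sum_(j < n.+1) (L j)^`N(k).[t] / (z - y j).
  rewrite /P (big_morph (nderivn k) (nderivnD k) (_ : _ = 0)); last first.
    by rewrite nderivn_poly0 ?size_poly0.
  rewrite horner_sum; apply: eq_bigr => j _.
  by rewrite nderivnZ hornerZ mulrC.
have E := interp_pole yinj sL hL zy; rewrite -/P -/omega -/c in E.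
case: l => [|k].
  rewrite add0r nderivn0 /q -PE nderivn0 expr1 mulrBr divff//.
  move: (congr1 (fun p => p.[t]) E); rewrite hornerD hornerM hornerXsubC hornerZ.
  by rewrite -polyC1 hornerC => <-; ring.
rewrite /q -!PE mulrBr exprS invfM mulrA divff// mul1r.
have := congr1 (fun p => (p^`N(k.+1)).[t]) E.
rewrite nderivnD hornerD horner_nderivn_mulXsubC -polyC1 nderivnC /= horner0 addr0.
rewrite nderivnZ hornerZ => <-; ring.
Qed.

End PolynomialIdentities.

(** * Taylor coefficients of the nodal polynomial and of the pole error *)

Section Estimates.
Variable R : realType.

(** The l-th Taylor coefficient is an elementary symmetric polynomial in the t - y_j; times h^l, its
    modulus is at most one part of the expansion of the product on the right, whose terms are all
    nonnegative. *)
Lemma nderiv_prod_XsubC_le (I : Type) (s : seq I) (y : I -> R[i]) (t : R[i]) (h : R) l :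
  0 <= h ->
  normc ((\prod_(j <- s) ('X - (y j)%:P))^`N(l)).[t] * h ^+ l <=
  \prod_(j <- s) (normc (t - y j) + h).
Proof.
move=> h0; elim: s l => [|j s IH] l.
  rewrite !big_nil -polyC1 nderivnC; case: l => [|l] /=.
    by rewrite hornerC normc1 mul1r expr0.
  by rewrite horner0 normc0 mul0r.
rewrite !big_cons; case: l => [|l].
  rewrite nderivn0 hornerM hornerXsubC normcM expr0 mulr1.
  rewrite ler_pM ?normc_ge0 ?lerDl//.
  by have := IH 0%N; rewrite nderivn0 expr0 mulr1.
rewrite [_ * \prod_(_ <- s) _]mulrC horner_nderivn_mulXsubC.
apply: (@le_trans _ _ ((normc (t - y j) * normc ((\prod_(j <- s) ('X - (y j)%:P))^`N(l.+1)).[t]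
   + normc ((\prod_(j <- s) ('X - (y j)%:P))^`N(l)).[t]) * h ^+ l.+1)).
  by rewrite ler_wpM2r ?exprn_ge0// (le_trans (le_normcD _ _))// normcM.
rewrite mulrDl [leRHS]mulrDl lerD//.
  by rewrite -mulrA ler_wpM2l ?normc_ge0.
by rewrite exprS mulrCA ler_wpM2l.
Qed.

Lemma lagrange_basis_node n (x : 'I_n.+1 -> R) i j : injective x ->
  (lagrange_basis x j).[x i] = (i == j)%:R.
Proof.
move=> xinj; rewrite /lagrange_basis horner_prod.
have [->|ij] := eqVneq i j.
  apply: big1 => k kj; rewrite hornerZ hornerXsubC mulVf// subr_eq0.
  by apply: contra kj => /eqP/xinj ->.
by rewrite (bigD1 i)//= hornerZ hornerXsubC subrr mulr0 mul0r.
Qed.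

Lemma size_lagrange_basis n (x : 'I_n.+1 -> R) j :
  (size (lagrange_basis x j) <= n.+1)%N.
Proof.
rewrite /lagrange_basis scaler_prod (leq_trans (size_scale_leq _ _))//.
rewrite -big_filter size_prod_XsubC size_filter -sum1_count sum1_card.
by rewrite cardC1 card_ord.
Qed.

(** Each step of the recursion of [interp_pole_coef] divides by z - t, at a cost of G, and adds one
    term W N^k / c. Since N and G are at least 1, the l + 1 accumulated terms are all below the last
    power, hence the factor l + 1. *)
Lemma normc_interp_pole_coef n (x : 'I_n.+1 -> R) (z : R[i]) (t c W G N : R) l :
  injective x -> (forall j, z != (x j)%:C) -> 1 <= N -> 1 <= G ->
  G^-1 <= normc (z - t%:C) ->
  \prod_(j < n.+1) (`|t - x j| + N^-1) <= W ->
  0 < c -> c <= \prod_(j < n.+1) normc (z - (x j)%:C) ->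
  normc ((z - t%:C) ^- l.+1 -
    \sum_(j < n.+1) (((lagrange_basis x j)^`N(l)).[t])%:C / (z - (x j)%:C)) <=
  W / c * N ^+ l * G ^+ l.+1 * l.+1%:R.
Proof.
move=> xinj zx N1 G1 Gz hW c0 hc.
have N0 : 0 < N by exact: lt_le_trans N1.
have G0 : 0 < G by exact: lt_le_trans G1.
pose y j : R[i] := (x j)%:C; pose L j := map_poly (real_complex R) (lagrange_basis x j).
pose omega := \prod_(j < n.+1) ('X - (y j)%:P).
pose q k : R[i] := (z - t%:C) ^- k.+1 - \sum_(j < n.+1) ((L j)^`N(k)).[t%:C] / (z - y j).
have -> : (z - t%:C) ^- l.+1 -
    \sum_(j < n.+1) (((lagrange_basis x j)^`N(l)).[t])%:C / (z - (x j)%:C) = q l.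
  congr (_ - _); apply: eq_bigr => j _.
  by rewrite nderivn_map horner_map.
have yinj : injective y by move=> i j /complexI/xinj.
have sL j : (size (L j) <= n.+1)%N by rewrite size_map_poly size_lagrange_basis.
have hL i j : (L j).[y i] = (i == j)%:R.
  by rewrite horner_map lagrange_basis_node// rmorph_nat.
have zt0 : 0 < normc (z - t%:C) by rewrite (lt_le_trans _ Gz)// invr_gt0.
have zt : z != t%:C by rewrite -subr_eq0 -normc_gt0.
have rec k := interp_pole_coef k yinj sL hL zx zt.
have oz : normc (omega.[z])^-1 <= c^-1.
  rewrite normcV lef_pV2 ?posrE//; last first.
    apply: (lt_le_trans c0); rewrite horner_prod normc_prod (le_trans hc)//.
    by rewrite le_eqVlt; apply/orP; left; apply/eqP/eq_bigr => j _; rewrite hornerXsubC.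
  rewrite horner_prod normc_prod (le_trans hc)//.
  by rewrite le_eqVlt; apply/orP; left; apply/eqP/eq_bigr => j _; rewrite hornerXsubC.
have W0 : 0 <= W.
  apply: le_trans hW; apply: prodr_ge0 => j _.
  by rewrite addr_ge0// invr_ge0 ltW.
have ot k : normc (omega^`N(k)).[t%:C] <= W * N ^+ k.
  rewrite -ler_pdivrMr ?exprn_gt0// -exprVn.
  have Ni : 0 <= N^-1 by rewrite invr_ge0 ltW.
  apply: le_trans (nderiv_prod_XsubC_le _ _ _ _ Ni) _; apply: le_trans hW.
  rewrite le_eqVlt; apply/orP; left; apply/eqP/eq_bigr => j _.
  by rewrite /y -rmorphB normc_real.
have step (k : nat) (b : R) (v : R[i]) : normc v <= b ->
    (z - t%:C) * q k = v + (omega.[z])^-1 * (omega^`N(k)).[t%:C] ->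
    normc (q k) <= G * (b + W / c * N ^+ k).
  move=> vb E; rewrite -ler_pdivrMl//.
  apply: (@le_trans _ _ (normc ((z - t%:C) * q k))).
    by rewrite normcM ler_wpM2r ?normc_ge0.
  rewrite E normcD_le// [leRHS](_ : _ = c^-1 * (W * N ^+ k)); last by ring.
  exact: normcM_le.
have Wc : 0 <= W / c by rewrite divr_ge0// ltW.
elim: l => [|l IH].
  apply: le_trans (step 0%N 0 0 _ (rec 0%N)) _; first by rewrite normc0.
  by rewrite add0r !expr0 expr1 !mulr1 mulrC.
apply: le_trans (step l.+1 _ _ IH (rec l.+1)) _.
set A := W / c.
have -> : A * N ^+ l.+1 * G ^+ l.+2 * l.+2%:R =
  G * (A * N ^+ l.+1 * G ^+ l.+1 * l.+1%:R + A * N ^+ l.+1 * G ^+ l.+1).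
  by rewrite -(natr1 l.+1) [G ^+ l.+2]exprS; ring.
rewrite ler_wpM2l ?(ltW G0)// lerD//.
  rewrite ler_wpM2r// ler_wpM2r ?exprn_ge0 ?(ltW G0)// ler_wpM2l//.
  by rewrite [N ^+ l.+1]exprS ler_peMl ?exprn_ge0 ?(ltW N0).
by rewrite ler_peMr ?exprn_ege1// mulr_ge0// exprn_ge0 ?(ltW N0).
Qed.

End Estimates.

(** * Assembly of the error bound, uniformly in the radius *)

Section ErrorBound.
Variable R : realType.

Definition node_const : R := (expR 2 + 1) * 5 * expR 168.

(** The first [rho] bounds [joukowski_dlog]. The last factor inverts the constant of [prod_node_ge],
    with (r - 1)^2 and (r^2 - 1)^2 lowered to b^2 and the remaining r raised to rho. The powers 2^n
    of the two nodal products cancel. *)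
Definition circle_const (b rho : R) : R :=
  rho * (node_const * (expR (8 * rho / b ^+ 2) * (2 * rho ^+ 3 / b ^+ 2))).

(** Bounds 1 / |z - t| through [joukowski_dist]; the added 1 makes its powers increasing. *)
Definition pole_const (b rho : R) : R := 1 + 2 * rho / b ^+ 2.

Lemma node_const_gt0 : 0 < node_const.
Proof. by rewrite !mulr_gt0 ?addr_gt0 ?expR_gt0. Qed.

Lemma circle_const_gt0 b rho : 0 < b -> 0 < rho -> 0 < circle_const b rho.
Proof.
move=> b0 r0; rewrite /circle_const !mulr_gt0 ?node_const_gt0 ?expR_gt0 ?invr_gt0//.
by rewrite !mulr_gt0.
Qed.

Lemma pole_const_ge1 b rho : 0 < b -> 0 < rho -> 1 <= pole_const b rho.
Proof.
by move=> b0 r0; rewrite lerDl divr_ge0 ?mulr_ge0 ?exprn_ge0// ltW.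
Qed.

Lemma normc_joukowski_dlog (w : R[i]) : 1 <= normc w ->
  normc (joukowski_dlog w) <= normc w.
Proof.
move=> w1; rewrite /joukowski_dlog normcM normcV (normc_nat _ 2) ler_pdivrMr//.
apply: le_trans (le_normcB _ _) _; rewrite normcV mulr_natr mulr2n lerD2l.
by rewrite (le_trans _ w1)// invf_le1// (lt_le_trans _ w1).
Qed.

Lemma coef_error_circle (rho r b sigma t r0 M : R) (n m : nat) (eps : 'I_n.+1 -> R)
    (f : R[i]^o -> R[i]^o) (a : nat -> R[i]) :
  let x := perturbed_node eps in
  0 < b -> 1 + b <= r < rho -> (0 < n)%N -> injective x ->
  (forall j, `|eps j| <= sigma) -> n%:R * sigma * (ln n%:R + 1) <= 1 ->
  (forall z, bernstein_ellipse rho z -> analytic_at f z) ->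
  (forall z, bernstein_ellipse rho z -> normc (f z) <= M) ->
  -1 <= t <= 1 -> 0 < r0 -> psum f a t%:C r0 ->
  normc (a m - \sum_(j < n.+1) (((lagrange_basis x j)^`N(m)).[t])%:C * f (x j)%:C)
  <= circle_const b rho * pole_const b rho ^+ m.+1 * m.+1%:R * M * n%:R ^+ (2 * m) / r ^+ n.
Proof.
move=> x b0 /andP[br rrho] n0 xinj heps ns fan fM t1 r00 fa.
have r1 : 1 < r by rewrite (lt_le_trans _ br)// ltrDl.
have rg0 : 0 < r by exact: lt_trans r1.
have rho0 : 0 < rho by exact: lt_trans rrho.
have br1 : b <= r - 1 by lra.
have nR1 : 1 <= n%:R :> R by rewrite ler1n.
have nR0 : 0 < n%:R :> R by rewrite ltr0n.
have sg0 : 0 <= sigma := le_trans (normr_ge0 _) (heps ord0).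
have ln0 : 0 <= ln n%:R :> R by rewrite ln_ge0.
have ns1 : n%:R * sigma <= 1.
  by apply: le_trans ns; rewrite ler_peMr ?mulr_ge0 ?(ltW nR0)// lerDr.
have b2 : b ^+ 2 <= (r - 1) ^+ 2 by rewrite lerXn2r ?nnegrE ?(ltW b0)//; lra.
have b20 : 0 < b ^+ 2 by rewrite exprn_gt0.
have r20 : 0 < (r - 1) ^+ 2 by rewrite (lt_le_trans b20).
have b3 : b ^+ 2 <= (r ^+ 2 - 1) ^+ 2.
  have rr : r - 1 <= r ^+ 2 - 1 by rewrite lerD2r expr2 ler_peMl// ltW.
  by rewrite lerXn2r ?nnegrE ?(ltW b0)//; lra.
have M0 : 0 <= M.
  have [v v1 tv] := real_joukowski t1.
  apply: le_trans (fM t%:C _); first exact: normc_ge0.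
  by rewrite tv; apply: joukowski_in_bernstein; rewrite v1 lexx (lt_trans r1).
pose c := expR (- (8 * rho / b ^+ 2)) * (b ^+ 2 / (2 * rho ^+ 3)) * (r / 2) ^+ n.
have c0 : 0 < c.
  apply: mulr_gt0; last by rewrite exprn_gt0// divr_gt0.
  apply: mulr_gt0; first exact: expR_gt0.
  by rewrite divr_gt0// mulr_gt0// exprn_gt0.
pose W := node_const / 2 ^+ n.
have Bnd0 : 0 <= circle_const b rho * pole_const b rho ^+ m.+1 * m.+1%:R * M * n%:R ^+ (2 * m) / r ^+ n.
  have cc := circle_const_gt0 b0 rho0; have pc := pole_const_ge1 b0 rho0.
  have pc0 : 0 <= pole_const b rho by rewrite (le_trans _ pc).
  move: cc pc0 {pc}; move: (circle_const b rho) (pole_const b rho) => X Y X0 Y0.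
  rewrite divr_ge0 ?exprn_ge0 ?(ltW rg0)//.
  by rewrite !mulr_ge0 ?exprn_ge0 ?(ltW X0) ?(ltW nR0).
apply: (coef_functional_le (rho := rho) (r := r) (r0 := r0) (t := t)) => //.
- by rewrite r1.
- by move=> j; exact: perturbed_node_itv.
move=> w wr; set z := joukowski w.
have zE : bernstein_ellipse rho z.
  by apply: joukowski_in_bernstein; rewrite wr rrho ltW.
have w1 : 1 < normc w by rewrite wr.
have dz s : -1 <= s <= 1 -> (r - 1) ^+ 2 / (2 * r) <= normc (z - s%:C).
  by move=> s1; rewrite -wr; exact: joukowski_dist.
have d0 : 0 < (r - 1) ^+ 2 / (2 * r) by rewrite divr_gt0// mulr_gt0.
have zx j : z != (x j)%:C.
  rewrite -subr_eq0 -normc_gt0 (lt_le_trans d0)// dz//.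
  exact: perturbed_node_itv.
have Gz : (pole_const b rho)^-1 <= normc (z - t%:C).
  apply: le_trans (dz _ t1); rewrite -[leRHS]invrK lef_pV2 ?posrE; last 2 first.
  - by rewrite (lt_le_trans _ (pole_const_ge1 b0 rho0)).
  - by rewrite invr_gt0.
  rewrite invf_div (@le_trans _ _ (2 * rho / b ^+ 2))//; last by rewrite lerDr.
  rewrite ler_pM ?mulr_ge0 ?invr_ge0 ?(ltW rg0) ?(ltW r20)//.
    by rewrite ler_wpM2l// ltW.
  by rewrite lef_pV2 ?posrE.
have hW : \prod_(j < n.+1) (`|t - x j| + (n%:R ^+ 2)^-1) <= W.
  by rewrite -exprVn; exact: (@prod_node_le R n n0 eps sigma heps t ns t1).
have hc : c <= \prod_(j < n.+1) normc (z - (x j)%:C).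
  apply: le_trans (@prod_node_ge R n n0 eps sigma heps w r ns1 r1 wr).
  rewrite /c ler_wpM2r ?exprn_ge0 ?divr_ge0 ?(ltW rg0)//.
  rewrite ler_pM ?expR_ge0 ?divr_ge0 ?mulr_ge0 ?exprn_ge0 ?(ltW b0) ?(ltW rho0)//.
    rewrite ler_expR lerN2 ler_pM ?mulr_ge0 ?invr_ge0 ?(ltW rg0) ?(ltW r20)//.
      by rewrite ler_wpM2l// ltW.
    by rewrite lef_pV2 ?posrE.
  rewrite ler_pM ?invr_ge0 ?mulr_ge0 ?exprn_ge0 ?(ltW b0) ?(ltW rho0)//.
  rewrite lef_pV2 ?posrE ?mulr_gt0 ?exprn_gt0// ler_wpM2l//.
  by rewrite lerXn2r ?nnegrE ?(ltW rg0) ?(ltW rho0) ?(ltW rrho).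
have N1 : 1 <= n%:R ^+ 2 :> R by rewrite exprn_ege1.
have hq := @normc_interp_pole_coef R n x z t c W (pole_const b rho) (n%:R ^+ 2) m
  xinj zx N1 (pole_const_ge1 b0 rho0) Gz hW c0 hc.
have hd : normc (joukowski_dlog w) <= rho.
  by rewrite (le_trans (normc_joukowski_dlog (ltW w1)))// wr ltW.
apply: le_trans (normcM_le hd (normcM_le (fM z zE) hq)) _.
rewrite le_eqVlt; apply/orP; left; apply/eqP.
rewrite /circle_const /c /W expRN exprM expr_div_n.
have A0 := exprn_gt0 n rg0; have B0 : 0 < 2 ^+ n :> R by rewrite exprn_gt0.
have E0 := expR_gt0 (8 * rho / b ^+ 2).
move: (r ^+ n) (2 ^+ n) (expR _) A0 B0 E0 => A B E A0 B0 E0.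
move: (_ ^+ 2 ^+ m) (pole_const _ _ ^+ _) => X Y.
by field; rewrite !gt_eqF.
Qed.

(** Analyticity in the open ellipse only allows r < rho. The bound of [coef_error_circle] has a
    constant free of r, so after multiplication by r^n both sides survive the limit r -> rho from
    the left. *)
Lemma coef_error_le (rho b sigma t r0 M : R) (n m : nat) (eps : 'I_n.+1 -> R)
    (f : R[i]^o -> R[i]^o) (a : nat -> R[i]) :
  let x := perturbed_node eps in
  0 < b -> 1 + b < rho -> (0 < n)%N -> injective x ->
  (forall j, `|eps j| <= sigma) -> n%:R * sigma * (ln n%:R + 1) <= 1 ->
  (forall z, bernstein_ellipse rho z -> analytic_at f z) ->
  (forall z, bernstein_ellipse rho z -> normc (f z) <= M) ->
  -1 <= t <= 1 -> 0 < r0 -> psum f a t%:C r0 ->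
  normc (a m - \sum_(j < n.+1) (((lagrange_basis x j)^`N(m)).[t])%:C * f (x j)%:C)
  <= circle_const b rho * pole_const b rho ^+ m.+1 * m.+1%:R * M * n%:R ^+ (2 * m) / rho ^+ n.
Proof.
move=> x b0 brho n0 xinj heps ns fan fM t1 r00 fa.
have rho0 : 0 < rho by lra.
set e := normc _; set B := _ * n%:R ^+ _.
rewrite ler_pdivlMr ?exprn_gt0//.
apply: (@cvgr_to_le _ rho^'- _ R (fun r => e * r ^+ n)).
  apply: cvg_at_left_filter; apply: cvgM; first exact: cvg_cst.
  exact: exprn_continuous.
near=> r; rewrite -ler_pdivlMr; last first.
  by rewrite exprn_gt0//; near: r; exact: nbhs_left_gt.
apply: (coef_error_circle (sigma := sigma) (r0 := r0)) => //; apply/andP; split.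
  by near: r; apply: nbhs_left_ge.
by near: r; exact: nbhs_left_lt.
Unshelve. all: by end_near. Qed.

Lemma derivn_error_le (rho b sigma t M : R) (n m : nat) (eps : 'I_n.+1 -> R)
    (f : R[i]^o -> R[i]^o) :
  let x := perturbed_node eps in
  0 < b -> 1 + b < rho -> (0 < n)%N -> injective x ->
  (forall j, `|eps j| <= sigma) -> n%:R * sigma * (ln n%:R + 1) <= 1 ->
  (forall z, bernstein_ellipse rho z -> analytic_at f z) ->
  (forall z, bernstein_ellipse rho z -> normc (f z) <= M) ->
  -1 <= t <= 1 ->
  normc ((f^`(m))%classic t%:C - (interpolant x f)^`(m).[t%:C]) <=
  m`!%:R * (circle_const b rho * pole_const b rho ^+ m.+1 * m.+1%:R) * M *
  (n%:R ^+ (2 * m) * rho ^- n).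
Proof.
move=> x b0 brho n0 xinj heps ns fan fM t1.
have tE : bernstein_ellipse rho t%:C.
  have [v v1 ->] := real_joukowski t1.
  by apply: joukowski_in_bernstein; rewrite v1 lexx; lra.
have [a [r0 [r00 fa]]] := fan _ tE.
rewrite (psum_derive1n m r00 fa).
have -> : (interpolant x f)^`(m).[t%:C] = m`!%:R *
    \sum_(j < n.+1) (((lagrange_basis x j)^`N(m)).[t])%:C * f (x j)%:C.
  rewrite nderivn_def hornerMn -mulr_natl; congr (_ * _).
  rewrite /interpolant (big_morph (nderivn m) (nderivnD m) (_ : _ = 0)); last first.
    by rewrite nderivn_poly0 ?size_poly0.
  rewrite horner_sum; apply: eq_bigr => j _.
  by rewrite nderivnZ hornerZ nderivn_map horner_map mulrC.
rewrite -mulrBr normcM normc_nat.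
have := @coef_error_le rho b sigma t r0 M n m eps f a b0 brho n0 xinj heps ns
  fan fM t1 r00 fa.
move: (circle_const b rho * _ * _) => K hK.
rewrite [leRHS](_ : _ = m`!%:R * (K * M * n%:R ^+ (2 * m) / rho ^+ n)); last by ring.
by rewrite ler_wpM2l.
Qed.

Lemma interpolant_diff_matrix n (x : 'I_n.+1 -> R) (f : R[i] -> R[i]) m i :
  (interpolant x f)^`(m).[(x i)%:C] = pseudospectral_diff x m f i.
Proof.
rewrite /interpolant /pseudospectral_diff.
rewrite (big_morph (derivn m) (derivnD m) (_ : _ = 0)); last by rewrite linear0.
rewrite horner_sum; apply: eq_bigr => j _.
by rewrite derivnZ hornerZ derivn_map horner_map mxE.
Qed.

End ErrorBound.

Theorem theorem5p1 (R : realType) (rho eta : R) (m : nat)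
  (rho_gt1 : 1 < rho) (m_ge1 : (1 <= m)%N)
  (eta_gt0 : 0 < eta) (eta_lt : eta < (1 + 2 / pi)^-1) :
  exists C : R, 0 < C /\
    forall (sigma : nat -> R) (eps : forall n : nat, 'I_n.+1 -> R)
      (f : R[i]^o -> R[i]^o),
    (forall n : nat, (1 <= n)%N ->
       [/\ injective (perturbed_node (eps n)),
           eps n ord0 = 0,
           eps n ord_max = 0,
           max_norm (eps n) <= sigma n
         & n%:R * sigma n * (ln n%:R + 1) <= eta]) ->
    (forall z : R[i], bernstein_ellipse rho z -> analytic_at f z) ->
    {within closure (bernstein_ellipse rho), continuous f} ->
    let M : \bar R := sup_norm (closure (bernstein_ellipse rho)) f in
    let fm : R[i] -> R[i] := (f^`(m))%classic in
    forall n : nat, (1 <= n)%N ->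
      let x : 'I_n.+1 -> R := perturbed_node (eps n) in
      let err (t : R) : R[i] := fm t%:C - (interpolant x f)^`(m).[t%:C] in
      let node_err (i : 'I_n.+1) : R :=
        normc (fm (x i)%:C - pseudospectral_diff x m f i) in
      let bound : \bar R := (C%:E * M *
        (n%:R ^+ (2 * m) * ln (expR 1 * n%:R) * rho ^- n)%:E)%E in
      (sup_norm [set t : R | -1 <= t <= 1]%R err <= bound)%E /\
      ((max_norm node_err)%:E <= bound)%E.
Proof.
have rho0 : 0 < rho by exact: lt_trans rho_gt1.
(* The midpoint 1 + b of 1 and rho keeps the circles away from |w| = 1, with constants depending on
   rho alone. *)
pose b := (rho - 1) / 2; have b0 : 0 < b by rewrite divr_gt0// subr_gt0.
have brho : 1 + b < rho by rewrite /b; lra.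
pose K := m`!%:R * (circle_const b rho * pole_const b rho ^+ m.+1 * m.+1%:R).
have pc0 : 0 < pole_const b rho by rewrite (lt_le_trans _ (pole_const_ge1 b0 rho0)).
have K0 : 0 < K.
  rewrite /K; move: (circle_const_gt0 b0 rho0) pc0.
  move: (circle_const b rho) (pole_const b rho) => X Y X0 Y0.
  by rewrite !mulr_gt0 ?ltr0n ?fact_gt0 ?exprn_gt0.
exists K; split=> // sigma eps f hyp fan _ M fm n n0 x err node_err bound.
(* As (1 + 2 / pi)^-1 < 1, the hypothesis yields n sigma (ln n + 1) <= 1, the form in which the
   nodal products use it. *)
have eta1 : eta <= 1.
  rewrite (le_trans (ltW eta_lt))// invf_le1 ?lerDl ?divr_ge0 ?pi_ge0//.
  by rewrite addr_gt0// divr_gt0// pi_gt0.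
have [xinj _ _ hmax hsig] := hyp n n0.
have heps j : `|eps n j| <= sigma n by apply: le_trans hmax; exact: le_bigmax.
have ns := le_trans hsig eta1.
have nR0 : 0 < n%:R :> R by rewrite ltr0n.
(* The estimate is obtained without a logarithm; the factor ln (e n) = 1 + ln n >= 1 only enlarges
   it. *)
have ln1 : 1 <= ln (expR 1 * n%:R) :> R.
  by rewrite lnM ?posrE ?expR_gt0// expRK lerDl ln_ge0// ler1n.
pose q := n%:R ^+ (2 * m) * ln (expR 1 * n%:R) * rho ^- n.
have q0 : 0 < q.
  by rewrite !mulr_gt0 ?invr_gt0 ?exprn_gt0// (lt_le_trans _ ln1).
have fM z : bernstein_ellipse rho z -> ((normc (f z))%:E <= M)%E.
  by move=> zE; apply: ereal_sup_ubound; exists z => //; exact: subset_closure.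
have errB t : -1 <= t <= 1 -> ((normc (err t))%:E <= bound)%E.
  move=> t1; rewrite /bound -/q.
  have : (0%:E <= M)%E.
    have [v v1 tv] := real_joukowski t1.
    apply: le_trans (fM t%:C _); first by rewrite lee_fin normc_ge0.
    by rewrite tv; apply: joukowski_in_bernstein; rewrite v1 lexx.
  (* The supremum is an extended real. If it is [+oo], so is the bound, because its other two
     factors are strictly positive; [-oo] is excluded by 0 <= M. *)
  case: M fM @bound => [M' fM _ M0||//]; last first.
    by move=> _ _ _; rewrite gt0_muley ?lte_fin// gt0_mulye ?lte_fin// leey.
  have M'0 : 0 <= M' by rewrite -lee_fin.
  rewrite -!EFinM lee_fin.
  have fM' z : bernstein_ellipse rho z -> normc (f z) <= M' by move=> /fM.
  apply: le_trans (derivn_error_le m b0 brho n0 xinj heps ns fan fM' t1) _.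
  have -> : q = n%:R ^+ (2 * m) * (ln (expR 1 * n%:R) * rho ^- n) by rewrite /q mulrA.
  rewrite -/K; apply: ler_wpM2l; first by rewrite mulr_ge0 ?(ltW K0).
  apply: ler_wpM2l; first by rewrite exprn_ge0 ?(ltW nR0).
  by rewrite ler_peMl// invr_ge0 exprn_ge0// ltW.
split; first by apply: ge_ereal_sup => _ [t t1 <-]; exact: errB.
have nodeB i : ((node_err i)%:E <= bound)%E.
  rewrite /node_err -interpolant_diff_matrix; apply: (errB (x i)).
  exact: perturbed_node_itv.
rewrite /max_norm; elim/big_ind: _ => [|y z yB zB|i _].
(* [max_norm] starts its maximum at 0, so 0 too must lie below the bound; one nonnegative node error
   shows it. *)
- by apply: le_trans (nodeB ord0); rewrite lee_fin normc_ge0.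
- by rewrite /Order.max; case: ifP.
- by rewrite ger0_norm ?normc_ge0.
Qed.
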